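(* Consider the perfect $4$-ary tree of depth $L\ge 1$ with $N=4^L$ leaves. At every non-leaf node the four downward edges are grouped in two pairs, exactly one edge in each pair being valid and the other invalid. Every valid edge carries the phase $\varphi_g$ and every invalid edge carries the phase $\varphi_b$, where $\{\varphi_g,\varphi_b\}=\{0,\pi/2\}$. Let $m$ be a marked leaf that is valid (reachable from the root using only valid edges), and let $n=2^L=\sqrt N$ be the number of valid leaves. Then the amplitude amplification algorithm described in the context, with spreading operator $U$, finds the marked vertex in $O(\sqrt[4]{N})$ steps with constant probability. That is, the algorithm performs $\lceil\frac{\pi}{4}\sqrt n\rceil=O(\sqrt[4]{N})$ steps (iterations, each using one application of the oracle $O_m$), and there is an absolute constant $c>0$, independent of $L$, of the assignment of valid edges and of $m$, such that the final measurement of the position register returns $m$ with probability at least $c$.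
   Context: Setting. Let $V$ be the node set of the tree, and let $r$ be its root. The Hilbert space is $\mathcal X=\mathcal X_P\otimes\mathcal X_C\otimes\mathcal X_M$. Here $\mathcal X_P$ (position) has orthonormal basis $\{|x\rangle: x\in V\}$. The space $\mathcal X_C$ (coin) has orthonormal basis $|0\rangle,|1\rangle,|2\rangle,|3\rangle,|\uparrow\rangle$. The space $\mathcal X_M=\mathbb C^2$ (memory) has orthonormal basis $|0\rangle,|1\rangle$. At each non-leaf node, directions $0,1,2,3$ label the four downward edges, paired as $\{2l,2l+1\}$ for $l=0,1$. At each non-root node, $\uparrow$ labels the edge to the parent. The direction $\uparrow$ at the root and the directions $0,\dots,3$ at the leaves are loops. The phase $\varphi(x,y)=\varphi(y,x)$ is $\varphi_g$ or $\varphi_b$ according to whether the edge is valid or invalid. Identify $g,b\in\{0,1\}$ with the memory basis labels determined by $2\varphi_g=2\pi g/2$ and $2\varphi_b=2\pi b/2$ (so phase $0$ has label $0$ and phase $\pi/2$ has label $1$). Operators (each acts as the identity on registers not mentioned): - Shift: $S|x,c\rangle=e^{i\varphi(x,y)}|y,c'\rangle$ if direction $c$ at $x$ leads along an edge to $y$ and $c'$ is the direction at $y$ leading back to $x$; $S|x,c\rangle=|x,c\rangle$ if $c$ is a loop at $x$. - For unit vectors $|a\rangle,|a_1\rangle$ with $|a\rangle$ and $|a_1\rangle$ linearly independent, let $U_{|a\rangle\to|a_1\rangle}$ be the operator that is the identity on the orthogonal complement of $\mathrm{span}(|a\rangle,|a_1\rangle)$, maps $|a\rangle\mapsto|a_1\rangle$,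 and maps $|a'\rangle\mapsto|a_1'\rangle$, where $|a'\rangle$ and $|a_1'\rangle$ are the normalizations of $|a_1\rangle-|a\rangle\langle a|a_1\rangle$ and $|a\rangle-|a_1\rangle\langle a_1|a\rangle$ respectively. - $P=\sum_{x}|x\rangle\langle x|\otimes U_{|0,0\rangle\to|s\rangle}$, where $|s\rangle=\frac{1}{\sqrt{8}}\sum_{c=0}^{3}\sum_{j=0}^{1}|c,j\rangle\in\mathcal X_C\otimes\mathcal X_M$. - Phase estimation: $E=(1_P\otimes 1_C\otimes\mathcal F^\dagger)\big(\sum_{j=0}^{1}(S^2)^j\otimes|j\rangle\langle j|\big)$, where $\mathcal F|k\rangle=\frac{1}{\sqrt2}\sum_{j=0}^{1}e^{2\pi i kj/2}|j\rangle$. - $C$ acts on $\mathcal X_C\otimes\mathcal X_M$. For $l=0,1$ put $|g_{2l}^{\pm}\rangle=|2l,g\rangle\pm|2l+1,b\rangle$ and $|g_{2l+1}^{\pm}\rangle=|2l,b\rangle\pm|2l+1,g\rangle$. Then $C$ is the unitary that acts, on the span of $|c,j\rangle$ with $c\in\{0,1,2,3\}$, $j\in\{0,1\}$, as $$\frac{1}{\sqrt2}\sum_{l=0}^{1}\Big(|2l,g\rangle\langle g_{2l}^+|+|2l+1,g\rangle\langle g_{2l+1}^+|+|2l+1,b\rangle\langle g_{2l+1}^-|+|2l,b\rangle\langle g_{2l}^-|\Big),$$ and as the identity on the span of $|\uparrow,j\rangle$. - $A=\sum_x|x\rangle\langle x|\otimes U_{|\uparrow,g\rangle\to|0,0\rangle}$.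 - Spreading operator: $U=(A\,S\,C\,E\,P)^L$ (one factor $ASCEP$ per layer of the tree; the rightmost operator acts first). - Oracle: $O_m=(1_P-2|m\rangle\langle m|)\otimes 1_C\otimes 1_M$. Algorithm. (1) Prepare the initial state $|\psi_0\rangle=|r\rangle\otimes|0\rangle\otimes|0\rangle$. (2) Apply $U$. (3) Repeat $\lceil\frac{\pi}{4}\sqrt n\rceil$ times (each repetition is one step): apply $O_m$, then $U^\dagger$, then $1-2|\psi_0\rangle\langle\psi_0|$, then $U$. (4) Measure the position register. *)

(* Defs.v *)
From HB Require Import structures.
From mathcomp Require Import all_boot all_order all_algebra.
From mathcomp Require Import all_classical all_reals all_analysis.
From mathcomp Require Import complex.
From mathcomp Require Import sesquilinear spectral.

Set Implicit Arguments.
Unset Strict Implicit.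
Unset Printing Implicit Defensive.

Import Order.TTheory GRing.Theory Num.Theory.

Local Open Scope ring_scope.
Local Open Scope complex_scope.
Local Open Scope sesquilinear_scope.

(* The Hilbert space with orthonormal basis indexed by a finite type T is
   'cV[R[i]]_#|T|, the basis vector of t : T being |ket t>; its operators are
   the matrices 'M[R[i]]_#|T|.  The tensor product of the spaces indexed by T
   and T' is the space indexed by T * T', and adjoints are conjugate
   transposes. *)
Section Hilbert.
Variable R : realType.
Local Notation C := R[i].

Definition vect (T : finType) := 'cV[C]_#|T|.
Definition oper (T : finType) := 'M[C]_#|T|.

Definition ket (T : finType) (t : T) : vect T := delta_mx (enum_rank t) 0.

Definition entry (T : finType) (M : oper T) (t t' : T) : C :=
  M (enum_rank t) (enum_rank t').

Definition mkoper (T : finType) (f : T -> T -> C) : oper T :=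
  \matrix_(i, j) f (enum_val i) (enum_val j).

(* <u|v>, antilinear in u *)
Definition inner (T : finType) (u v : vect T) : C := (u ^t* *m v) 0 0.

(* |u><v| *)
Definition outer (T : finType) (u v : vect T) : oper T := u *m v ^t*.

Definition normalize (T : finType) (u : vect T) : vect T :=
  (sqrtC (inner u u))^-1 *: u.

(* the linear operator mapping |ket t> to |f t> *)
Definition on_basis (T : finType) (f : T -> vect T) : oper T :=
  \sum_(t : T) outer (f t) (ket t).

Definition tens (A B : finType) (M : oper A) (N : oper B) :
    oper (A * B)%type :=
  mkoper (fun u v => entry M u.1 v.1 * entry N u.2 v.2).

(* reassociation of the three registers *)
Definition reassoc (A B D : finType) (M : oper (A * (B * D))%type) :
    oper (A * B * D)%type :=
  mkoper (fun u v => entry M (u.1.1, (u.1.2, u.2)) (v.1.1, (v.1.2, v.2))).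

Definition expi (t : R) : C := (cos t) +i* (sin t).

(* U_{|a> -> |a1>}.  As (a, a') is an orthonormal basis of span(a, a1), the
   projector onto the orthogonal complement of this span is
   1 - |a><a| - |a'><a'|. *)
Definition transfer (T : finType) (a a1 : vect T) : oper T :=
  let a'  := normalize (a1 - inner a a1 *: a) in
  let a1' := normalize (a - inner a1 a *: a1) in
  (1%:M - outer a a - outer a' a') + outer a1 a + outer a1' a'.

End Hilbert.

(* A node of the perfect 4-ary tree of depth L is the sequence, of length at
   most L, of the directions leading to it from the root. *)
Section Tree.
Variable L : nat.

Definition node := L.-bseq 'I_4.

Definition root_node : node := [bseq].

Definition leaf (x : node) : bool := size x == L.

(* Some d is the downward direction d, and None is the direction "up" *)
Definition coin := option 'I_4.

(* [leads x c y c']: direction c at x leads along an edge to y, and c' is the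
   direction at y leading back to x.  A direction at x that leads nowhere is a
   loop; by the bound on the length of nodes these are exactly None at the
   root and Some d at the leaves. *)
Definition leads (x : node) (c : coin) (y : node) (c' : coin) : bool :=
  match c, c' with
  | Some d, None => (y : seq 'I_4) == rcons x d
  | None, Some d => (x : seq 'I_4) == rcons y d
  | _, _ => false
  end.

(* downward directions 2l and 2l+1 *)
Definition even_dir (l : 'I_2) : 'I_4 := inord l.*2.
Definition odd_dir (l : 'I_2) : 'I_4 := inord l.*2.+1.

(* [v x d] tells whether the edge going down from x in direction d is valid;
   its values at the leaves are irrelevant. *)
Variable v : node -> 'I_4 -> bool.

Definition one_valid_per_pair : Prop :=
  forall x : node, ~~ leaf x ->
  forall l : 'I_2, v x (even_dir l) (+) v x (odd_dir l).

Definition valid_edge (x y : node) : bool :=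
  [exists d : 'I_4, (leads x (Some d) y None && v x d)
                 || (leads y (Some d) x None && v y d)].

Definition valid_leaf (x : node) : bool :=
  leaf x && connect valid_edge root_node x.

End Tree.
Arguments root_node {L}.

Section Algorithm.
Variables (R : realType) (L : nat) (v : node L -> 'I_4 -> bool).
Variables (phig phib : R) (g b : 'I_2).

Local Notation C := R[i].
Local Notation V := (node L).
Local Notation mem := 'I_2.
Local Notation up := (None : coin).
Local Notation basis := (V * coin * mem)%type.

Definition phase (x y : V) : R := if valid_edge v x y then phig else phib.

Definition S_PC : oper R (V * coin)%type :=
  on_basis (fun xc : V * coin =>
    if [pick yc : V * coin | leads xc.1 xc.2 yc.1 yc.2] is Some yc
    then expi (phase xc.1 yc.1) *: ket R yc
    else ket R xc).

Definition S_op : oper R basis := tens S_PC 1%:M.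

(* sum_x |x><x| (x) W *)
Definition at_each_node (W : oper R (coin * mem)%type) : oper R basis :=
  reassoc (\sum_(x : V) tens (outer (ket R x) (ket R x)) W).

Definition kcm (c : coin) (j : mem) : vect R (coin * mem)%type := ket R (c, j).

Definition s_ket : vect R (coin * mem)%type :=
  (sqrtC 8)^-1 *: \sum_(c < 4) \sum_(j : mem) kcm (Some c) j.

Definition P_op : oper R basis :=
  at_each_node (transfer (kcm (Some ord0) ord0) s_ket).

Definition F_M : oper R mem :=
  on_basis (fun k : mem =>
    (sqrtC 2)^-1 *:
      \sum_(j : mem) expi (2 * pi * k%:R * j%:R / 2) *: ket R j).

Definition E_op : oper R basis :=
  tens (1%:M : oper R (V * coin)%type) (F_M ^t*) *m
  \sum_(j : mem) tens ((S_PC ^+ 2) ^+ j) (outer (ket R j) (ket R j)).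

(* |g_{2l}^{+-}> and |g_{2l+1}^{+-}>, with sg the sign 1 or -1 *)
Definition g_even (l : 'I_2) (sg : C) : vect R (coin * mem)%type :=
  kcm (Some (even_dir l)) g + sg *: kcm (Some (odd_dir l)) b.
Definition g_odd (l : 'I_2) (sg : C) : vect R (coin * mem)%type :=
  kcm (Some (even_dir l)) b + sg *: kcm (Some (odd_dir l)) g.

Definition C_CM : oper R (coin * mem)%type :=
  (sqrtC 2)^-1 *: \sum_(l < 2)
     (outer (kcm (Some (even_dir l)) g) (g_even l 1)
    + outer (kcm (Some (odd_dir l)) g) (g_odd l 1)
    + outer (kcm (Some (odd_dir l)) b) (g_odd l (-1))
    + outer (kcm (Some (even_dir l)) b) (g_even l (-1)))
  + \sum_(j : mem) outer (kcm up j) (kcm up j).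

Definition C_op : oper R basis := reassoc (tens 1%:M C_CM).

Definition A_op : oper R basis :=
  at_each_node (transfer (kcm up g) (kcm (Some ord0) ord0)).

Definition U_op : oper R basis :=
  (A_op *m S_op *m C_op *m E_op *m P_op) ^+ L.

Definition oracle (m : V) : oper R basis :=
  tens (tens (1%:M - outer (ket R m) (ket R m) *+ 2) 1%:M) 1%:M.

Definition psi0 : vect R basis := ket R (root_node, Some ord0, ord0).

(* one iteration of amplitude amplification: O_m first, then U^dagger, etc. *)
Definition iteration (m : V) : oper R basis :=
  U_op *m (1%:M - outer psi0 psi0 *+ 2) *m U_op ^t* *m oracle m.

Definition final_state (m : V) (k : nat) : vect R basis :=
  iter k (mulmx (iteration m)) (U_op *m psi0).

(* Born rule for a measurement of the position register *)
Definition prob_position (psi : vect R basis) (x : V) : R :=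
  \sum_(c : coin) \sum_(j : mem)
     complex.Re (`|inner (ket R (x, c, j)) psi| ^+ 2).

End Algorithm.

(* the number of iterations for n valid leaves; the ceiling is nonnegative, so
   the absolute value only converts it to nat *)
Definition nb_steps (R : realType) (n : nat) : nat :=
  `|Num.ceil (pi / 4 * Num.sqrt (n%:R : R))|%N.

(* Main.v *)
(* After k rounds A S C E P, the spreading operator has produced the uniform
   superposition of the valid nodes of depth k, up to a global phase: P spreads
   coin and memory, phase estimation E records in the memory whether an edge is
   valid, C interferes each pair of edges so that only the valid one survives,
   S follows it and A resets coin and memory.  As U is unitary, each iteration is
   minus a Grover rotation by 2t with sin t = 1 / sqrt n in the plane spanned by
   U psi0 and the marked vector, so that m is observed after k steps with
   probability at least sin ((2k + 1) t) ^ 2.  For n >= 8 and k the chosen number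
   of steps, (2k + 1) t lies between pi / 2 and pi - 1 / 5; for n = 2 and n = 4
   the squared sine is at least 1 / 4 for every k. *)
Require Import Defs.
From HB Require Import structures.
From mathcomp Require Import all_boot all_order all_algebra.
From mathcomp Require Import all_classical all_reals all_analysis.
From mathcomp Require Import complex.
From mathcomp Require Import sesquilinear spectral.
From mathcomp Require Import zify ring lra.
Import Order.TTheory GRing.Theory Num.Theory.
Import numFieldNormedType.Exports.

Set Implicit Arguments.
Unset Strict Implicit.
Unset Printing Implicit Defensive.

Local Open Scope classical_set_scope.
Local Open Scope ring_scope.

(** * Vectors and operators indexed by finite types *)

(** [U] is computed on [psi0] alone. Conjugating the reflection about [psi0] by [U] gives the
    reflection about [U psi0], so for every other state only the unitarity of [U] matters; this is
    why each of the five factors is shown unitary on the whole space, including at leaves, at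
    invalid nodes and on loops. One memory qubit makes phase estimation exact because a round trip
    along an edge multiplies a state by 1 or -1. Every valid inner node has exactly two valid
    children, so each round scales amplitudes by a number of modulus 1 / sqrt 2, and the marked
    amplitude has modulus exactly 1 / sqrt n. Its phase is carried along as a unit scalar, which
    disappears only in the final squared modulus. The margin 1 / 5 pays for the ceiling in the
    number of steps: it may add almost a whole turn by 2t, on top of the initial angle t and of the
    gap between t and sin t. For n = 2 the angle reached is 5 pi / 4, outside that window, hence the
    separate treatment of small n. *)

Lemma mulmx_finE (K : pzSemiRingType) (T : finType) m p
    (M : 'M[K]_(m, #|T|)) (N : 'M[K]_(#|T|, p)) i j :
  (M *m N) i j = \sum_(u : T) M i (enum_rank u) * N (enum_rank u) j.
Proof. by rewrite mxE (reindex enum_rank) //=; exact/onW_bij/enum_rank_bij. Qed.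

Section Hilbert.
Local Open Scope sesquilinear_scope.
Variables (R : realType).
Local Notation C := R[i].

Section OneRegister.
Variable T : finType.
Implicit Types (u v w : vect R T) (M N : oper R T) (t : T).

Lemma vectP u v : (forall t, u (enum_rank t) 0 = v (enum_rank t) 0) -> u = v.
Proof.
by move=> uv; apply/colP => k; rewrite -[k]enum_valK uv.
Qed.

Lemma operP M N : (forall t t', entry M t t' = entry N t t') -> M = N.
Proof.
by move=> MN; apply/matrixP => k l; rewrite -[k]enum_valK -[l]enum_valK; exact: MN.
Qed.

Lemma ketE t t' : ket R t (enum_rank t') 0 = (t' == t)%:R.
Proof. by rewrite mxE eqxx andbT (inj_eq enum_rank_inj). Qed.

Lemma mulmx_ketE M t t' : (M *m ket R t) (enum_rank t') 0 = entry M t' t.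
Proof.
rewrite mulmx_finE (bigD1 t) //= ketE eqxx mulr1 big1 ?addr0 // => u ut.
by rewrite ketE (negbTE ut) mulr0.
Qed.

Lemma oper_ketP M N : (forall t, M *m ket R t = N *m ket R t) -> M = N.
Proof.
by move=> MN; apply: operP => t t'; rewrite -!mulmx_ketE MN.
Qed.

Lemma adjmxM m n p (A : 'M[C]_(m, n)) (B : 'M[C]_(n, p)) :
  (A *m B) ^t* = B ^t* *m A ^t*.
Proof. by rewrite trmx_mul map_mxM. Qed.

Lemma adjmxK m n (A : 'M[C]_(m, n)) : (A ^t*) ^t* = A.
Proof. by apply/matrixP => i j; rewrite !mxE conjCK. Qed.

Lemma adjmxD m n (A B : 'M[C]_(m, n)) : (A + B) ^t* = A ^t* + B ^t*.
Proof. by rewrite linearD /= map_mxD. Qed.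

Lemma adjmxZ m n a (A : 'M[C]_(m, n)) : (a *: A) ^t* = a^* *: A ^t*.
Proof. by rewrite linearZ /= map_mxZ. Qed.

Lemma adjmx_sum m n I (r : seq I) (P : pred I) (F : I -> 'M[C]_(m, n)) :
  (\sum_(i <- r | P i) F i) ^t* = \sum_(i <- r | P i) (F i) ^t*.
Proof.
apply: (big_morph (fun A => A ^t*) (@adjmxD m n)).
by rewrite trmx0 map_mx0.
Qed.

Lemma adjmx1 n : (1%:M : 'M[C]_n) ^t* = 1%:M.
Proof. by rewrite trmx1 map_mx1. Qed.

Lemma innerC u v : inner v u = (inner u v)^*.
Proof.
rewrite /inner; transitivity (((u ^t* *m v) ^t*) 0 0).
  by rewrite adjmxM adjmxK.
by rewrite [LHS]mxE [in LHS]mxE.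
Qed.

Lemma innerDr u v w : inner u (v + w) = inner u v + inner u w.
Proof. by rewrite /inner mulmxDr mxE. Qed.

Lemma innerZr a u v : inner u (a *: v) = a * inner u v.
Proof. by rewrite /inner -scalemxAr mxE. Qed.

Lemma innerBr u v w : inner u (v - w) = inner u v - inner u w.
Proof. by rewrite innerDr -scaleN1r innerZr mulN1r. Qed.

Lemma innerDl u v w : inner (u + v) w = inner u w + inner v w.
Proof. by rewrite /inner adjmxD mulmxDl mxE. Qed.

Lemma innerZl a u v : inner (a *: u) v = a^* * inner u v.
Proof. by rewrite /inner adjmxZ -scalemxAl mxE. Qed.

Lemma innerBl u v w : inner (u - v) w = inner u w - inner v w.
Proof. by rewrite innerDl -scaleN1r innerZl rmorphN1 mulN1r. Qed.

Lemma inner0r u : inner u 0 = 0. Proof. by rewrite /inner mulmx0 mxE. Qed.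

Lemma inner_sumr I (r : seq I) (P : pred I) (F : I -> vect R T) u :
  inner u (\sum_(i <- r | P i) F i) = \sum_(i <- r | P i) inner u (F i).
Proof. exact: (big_morph _ (innerDr u) (inner0r u)). Qed.

Lemma inner_suml I (r : seq I) (P : pred I) (F : I -> vect R T) u :
  inner (\sum_(i <- r | P i) F i) u = \sum_(i <- r | P i) inner (F i) u.
Proof.
rewrite innerC inner_sumr rmorph_sum; apply: eq_bigr => i _.
by rewrite [RHS]innerC.
Qed.

Lemma inner_ketl t u : inner (ket R t) u = u (enum_rank t) 0.
Proof.
rewrite /inner mulmx_finE (bigD1 t) //= !mxE eqxx conjC1 mul1r big1 ?addr0 //.
by move=> s st; rewrite !mxE (inj_eq enum_rank_inj) (negbTE st) conjC0 mul0r.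
Qed.

Lemma inner_ket t t' : inner (ket R t) (ket R t') = (t == t')%:R.
Proof. by rewrite inner_ketl ketE. Qed.

Lemma inner_adj M u v : inner u (M *m v) = inner (M ^t* *m u) v.
Proof. by rewrite /inner adjmxM adjmxK mulmxA. Qed.

Lemma mul_outer u v w : outer u v *m w = inner v w *: u.
Proof.
by rewrite /outer -mulmxA [v ^t* *m w]mx11_scalar mul_mx_scalar.
Qed.

Lemma adj_outer u v : (outer u v) ^t* = outer v u.
Proof. by rewrite /outer adjmxM adjmxK. Qed.

Lemma inner_unitary M u v : M \is unitarymx -> inner (M *m u) (M *m v) = inner u v.
Proof.
move=> /unitarymxP/mulmx1C uM.
by rewrite inner_adj mulmxA uM mul1mx.
Qed.

(** Preserving the Gram matrix of the basis makes the adjoint a left inverse; for square matrices it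
    is then the right inverse that [unitarymx] asks for. *)
Lemma unitary_isometry M :
  (forall t t', inner (M *m ket R t) (M *m ket R t') = (t == t')%:R) ->
  M \is unitarymx.
Proof.
move=> isoM; apply/unitarymxP/mulmx1C; apply: operP => t t'.
rewrite -mulmx_ketE -inner_ketl -mulmxA inner_adj adjmxK isoM.
by rewrite /entry mxE (inj_eq enum_rank_inj).
Qed.

Lemma on_basis_ket (f : T -> vect R T) t : on_basis f *m ket R t = f t.
Proof.
rewrite /on_basis mulmx_suml (bigD1 t) //= mul_outer inner_ket eqxx scale1r.
rewrite big1 ?addr0 // => s st.
by rewrite mul_outer inner_ket (negbTE st) scale0r.
Qed.

Lemma unitarymx1 n : (1%:M : 'M[C]_n) \is unitarymx.
Proof. by apply/unitarymxP; rewrite adjmx1 mulmx1. Qed.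

Lemma expmx_unitary n (M : 'M[C]_n) k : M \is unitarymx -> M ^+ k \is unitarymx.
Proof.
move=> uM; elim: k => [|k IHk]; first exact: unitarymx1.
by rewrite exprS; exact: mul_unitarymx uM IHk.
Qed.

(** With t = <a|a1> and nu = sqrt (1 - |t|^2), the two Gram-Schmidt vectors satisfy a1 = t a + nu a'
    and a1' = nu a - t^* a', so (a, a') and (a1, a1') are orthonormal bases of one plane. For unit
    vectors the strict bound on the inner product is linear independence, and it keeps nu
    nonzero. *)
Lemma transferP (a a1 : vect R T) :
  inner a a = 1 -> inner a1 a1 = 1 -> `|inner a a1| < 1 ->
  exists a' a1' : vect R T,
  [/\ inner a a' = 0, inner a' a' = 1, inner a1 a1' = 0, inner a1' a1' = 1 &
  [/\ exists x y, a1 = x *: a + y *: a', exists x y, a1' = x *: a + y *: a' &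
      transfer a a1 =
        (1%:M - outer a a - outer a' a') + outer a1 a + outer a1' a']].
Proof.
move=> aa bb ab1; rewrite /transfer.
set t := inner a a1; have ta : inner a1 a = t^* by rewrite innerC.
set q := 1 - t * t^*.
have q_gt0 : 0 < q by rewrite /q -normCK subr_gt0 expr_lt1.
set w := a1 - t *: a; set w1 := a - inner a1 a *: a1.
have ww : inner w w = q.
  by rewrite /w !(innerBl, innerBr, innerZl, innerZr) aa bb ta -/t /q; ring.
have ww1 : inner w1 w1 = q.
  rewrite /w1 !(innerBl, innerBr, innerZl, innerZr) aa bb ta -/t /q conjCK; ring.
have aw : inner a w = 0 by rewrite /w innerBr innerZr aa -/t; ring.
have bw : inner a1 w1 = 0 by rewrite /w1 innerBr innerZr bb ta; ring.
rewrite /normalize ww ww1; set nu := sqrtC q.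
have nu_neq0 : nu != 0 by rewrite sqrtC_eq0 gt_eqF.
have nuV : (nu^-1)^* = nu^-1.
  by apply: CrealP; rewrite ger0_real // invr_ge0 sqrtC_ge0 ltW.
have nu2 : nu ^+ 2 = q by exact: sqrtCK.
have tt : t * t^* = 1 - nu ^+ 2 by rewrite nu2 /q; ring.
exists (nu^-1 *: w), (nu^-1 *: w1); split.
- by rewrite innerZr aw mulr0.
- by rewrite innerZl innerZr nuV ww -nu2 expr2 mulKf ?mulVf.
- by rewrite innerZr bw mulr0.
- by rewrite innerZl innerZr nuV ww1 -nu2 expr2 mulKf ?mulVf.
split=> //.
- exists t, nu; rewrite scalerA divff // scale1r /w addrC subrK //.
- exists nu, (- t^*); rewrite /w1 ta /w; apply/colP => k; rewrite !mxE.
  apply/eqP; rewrite -subr_eq0; set x := a k 0; set x1 := a1 k 0.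
  have -> : nu^-1 * (x - t^* * x1) - (nu * x + - t^* * (nu^-1 * (x1 - t * x)))
          = nu^-1 * (1 - nu ^+ 2 - t * t^*) * x by field.
  by rewrite tt subrr mulr0 mul0r.
Qed.

Lemma transferE (a a1 : vect R T) :
  inner a a = 1 -> inner a1 a1 = 1 -> `|inner a a1| < 1 ->
  transfer a a1 *m a = a1.
Proof.
move=> aa bb ab; have [a' [b' [aa' _ _ _ [_ _ ->]]]] := transferP aa bb ab.
have a'a : inner a' a = 0 by rewrite innerC aa' conjC0.
rewrite !mulmxDl !mulNmx !mul_outer mul1mx aa a'a !scale0r !scale1r.
by rewrite subrr subr0 add0r addr0.
Qed.

(** On the plane one orthonormal basis is carried to another, and off the plane the operator is the
    projector [Q]. The image of [Q] is orthogonal to all four vectors, so the part of an inner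
    product removed by [Q] is restored exactly by the images in the plane. *)
Lemma transfer_unitary (a a1 : vect R T) :
  inner a a = 1 -> inner a1 a1 = 1 -> `|inner a a1| < 1 ->
  transfer a a1 \is unitarymx.
Proof.
move=> aa bb ab.
have [a' [b' [aa' a'a' bb' b'b' [[x [y defb]] [x' [y' defb']] ->]]]] :=
  transferP aa bb ab.
have a'a : inner a' a = 0 by rewrite innerC aa' conjC0.
have b'b : inner b' a1 = 0 by rewrite innerC bb' conjC0.
pose Q := 1%:M - outer a a - outer a' a'; rewrite -/Q.
have QE u : Q *m u = u - inner a u *: a - inner a' u *: a'.
  by rewrite !mulmxDl !mulNmx !mul_outer mul1mx.
clearbody Q.
have aQ u : inner a (Q *m u) = 0.
  by rewrite QE !innerBr !innerZr aa aa'; ring.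
have a'Q u : inner a' (Q *m u) = 0.
  by rewrite QE !innerBr !innerZr a'a a'a'; ring.
have bQ u : inner a1 (Q *m u) = 0.
  by rewrite {1}defb innerDl !innerZl aQ a'Q !mulr0 addr0.
have b'Q u : inner b' (Q *m u) = 0.
  by rewrite {1}defb' innerDl !innerZl aQ a'Q !mulr0 addr0.
have Qb u : inner (Q *m u) a1 = 0 by rewrite innerC bQ conjC0.
have Qb' u : inner (Q *m u) b' = 0 by rewrite innerC b'Q conjC0.
have QQ u v : inner (Q *m u) (Q *m v) =
    inner u v - (inner a u)^* * inner a v - (inner a' u)^* * inner a' v.
  rewrite {1}QE !innerBl !innerZl aQ a'Q QE !innerBr !innerZr.
  rewrite (innerC a u) (innerC a' u).
  move: (inner u v) (inner a u) (inner a v) (inner a' u) (inner a' v) => ? ? ? ? ?.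
  by ring.
apply: unitary_isometry => t t'; rewrite !mulmxDl !mul_outer.
rewrite !(innerDl, innerDr, innerZl, innerZr) QQ !Qb !Qb' !bQ !b'Q.
rewrite bb bb' b'b b'b' -inner_ket.
move: (inner a _) (inner a' _) (inner a _) (inner a' _) (inner _ _) => ? ? ? ? ?.
by ring.
Qed.

End OneRegister.

(** * Tensor products of two registers *)

Section Tensor.
Variables A B : finType.
Implicit Types (M : oper R A) (N : oper R B).

Lemma entry_mkoper (T : finType) (f : T -> T -> C) t t' :
  entry (mkoper f) t t' = f t t'.
Proof. by rewrite /entry mxE !enum_rankK. Qed.

Lemma entry_mulmx (T : finType) (M N : oper R T) t t' :
  entry (M *m N) t t' = \sum_u entry M t u * entry N u t'.
Proof. exact: mulmx_finE. Qed.

Lemma entry1 (T : finType) (t t' : T) : entry (1%:M : oper R T) t t' = (t == t')%:R.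
Proof. by rewrite /entry mxE (inj_eq enum_rank_inj). Qed.

Lemma entry_adj (T : finType) (M : oper R T) t t' :
  entry (M ^t*) t t' = (entry M t' t)^*.
Proof. by rewrite /entry !mxE. Qed.

Lemma tens_mul M M' N N' : tens M N *m tens M' N' = tens (M *m M') (N *m N').
Proof.
apply: operP => -[a b] [a' b']; rewrite entry_mulmx !entry_mkoper /= !entry_mulmx.
rewrite big_distrlr pair_big /=; apply: eq_bigr => -[c d] _.
by rewrite !entry_mkoper /= mulrACA.
Qed.

Lemma tens_adj M N : (tens M N) ^t* = tens (M ^t*) (N ^t*).
Proof.
by apply: operP => -[a b] [a' b']; rewrite !(entry_adj, entry_mkoper) /= rmorphM.
Qed.

Lemma tens1 : tens (1%:M : oper R A) (1%:M : oper R B) = 1%:M.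
Proof.
apply: operP => -[a b] [a' b'].
by rewrite !(entry1, entry_mkoper) /= xpair_eqE -natrM mulnb.
Qed.

Lemma tens_unitary M N :
  M \is unitarymx -> N \is unitarymx -> tens M N \is unitarymx.
Proof.
move=> /unitarymxP uM /unitarymxP uN; apply/unitarymxP.
by rewrite tens_adj tens_mul uM uN tens1.
Qed.

Definition tensv (u : vect R A) (v : vect R B) : vect R (A * B)%type :=
  \col_i (u (enum_rank (enum_val i).1) 0 * v (enum_rank (enum_val i).2) 0).

Lemma tensvE u v a b :
  tensv u v (enum_rank (a, b)) 0 = u (enum_rank a) 0 * v (enum_rank b) 0.
Proof. by rewrite mxE enum_rankK. Qed.

Lemma ket_pair (a : A) (b : B) : ket R (a, b) = tensv (ket R a) (ket R b).
Proof.
apply: vectP => -[a' b']; rewrite tensvE !ketE xpair_eqE.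
by rewrite -natrM mulnb.
Qed.

Lemma tensvDr u v w : tensv u (v + w) = tensv u v + tensv u w.
Proof. by apply/colP => i; rewrite !mxE mulrDr. Qed.

Lemma tensvZr a u v : tensv u (a *: v) = a *: tensv u v.
Proof. by apply/colP => i; rewrite !mxE mulrCA. Qed.

Lemma tensvZl a u v : tensv (a *: u) v = a *: tensv u v.
Proof. by apply/colP => i; rewrite !mxE mulrA. Qed.

Lemma mul_tens M N u v : tens M N *m tensv u v = tensv (M *m u) (N *m v).
Proof.
apply: vectP => -[a b]; rewrite mulmx_finE tensvE !mulmx_finE.
rewrite big_distrlr pair_big /=; apply: eq_bigr => -[c d] _.
by rewrite tensvE -/(entry _ _ _) entry_mkoper /= mulrACA.
Qed.

Lemma inner_tensv u u' v v' :
  inner (tensv u v) (tensv u' v') = inner u u' * inner v v'.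
Proof.
rewrite /inner !mulmx_finE big_distrlr pair_big /=; apply: eq_bigr => -[a b] _.
by rewrite !(mxE, enum_rankK) /= rmorphM mulrACA.
Qed.

Lemma tensv_sumr I (r : seq I) (P : pred I) (F : I -> vect R B) u :
  tensv u (\sum_(i <- r | P i) F i) = \sum_(i <- r | P i) tensv u (F i).
Proof.
apply: (big_morph _ (tensvDr u)); apply/colP => k; rewrite !mxE mulr0 //.
Qed.

Lemma tensr_suml I (r : seq I) (P : pred I) (F : I -> oper R A) N :
  \sum_(i <- r | P i) tens (F i) N = tens (\sum_(i <- r | P i) F i) N.
Proof.
apply/esym/(big_morph (fun M => tens M N)) => [M M'|].
  by apply: operP => t t'; rewrite /entry !mxE /entry mxE mulrDl.
by apply: operP => t t'; rewrite /entry !mxE /entry mxE mul0r.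
Qed.

Lemma sum_outer_ket : \sum_(a : A) outer (ket R a) (ket R a) = 1%:M.
Proof.
apply: oper_ketP => a; rewrite mul1mx; exact: (on_basis_ket (fun a => ket R a)).
Qed.

End Tensor.

(** * The two bracketings of three registers *)

Section Reassociation.
Variables A B D : finType.
Implicit Types (M N : oper R (A * (B * D))%type).

Lemma sum_reassoc (F : A * (B * D) -> C) :
  \sum_t F t = \sum_(t : A * B * D) F (t.1.1, (t.1.2, t.2)).
Proof.
rewrite (reindex (fun t : A * B * D => (t.1.1, (t.1.2, t.2)))) //.
by apply: onW_bij; exists (fun t => (t.1, t.2.1, t.2.2)) => [[[]]|[? []]].
Qed.

Lemma reassoc_mul M N : reassoc M *m reassoc N = reassoc (M *m N).
Proof.
apply: operP => t t'; rewrite entry_mulmx !entry_mkoper entry_mulmx sum_reassoc.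
by apply: eq_bigr => u _; rewrite !entry_mkoper.
Qed.

Lemma reassoc_unitary M : M \is unitarymx -> reassoc M \is unitarymx.
Proof.
move=> /unitarymxP uM; apply/unitarymxP.
have -> : (reassoc M) ^t* = reassoc (M ^t*).
  by apply: operP => t t'; rewrite !(entry_adj, entry_mkoper).
rewrite reassoc_mul uM; apply: operP => -[[a b] d] [[a' b'] d'].
by rewrite !(entry1, entry_mkoper) /= !xpair_eqE andbA.
Qed.

Definition reassocv (w : vect R (A * (B * D))%type) : vect R (A * B * D)%type :=
  \col_i w (enum_rank ((enum_val i).1.1, ((enum_val i).1.2, (enum_val i).2))) 0.

Lemma reassocvE w a b d :
  reassocv w (enum_rank (a, b, d)) 0 = w (enum_rank (a, (b, d))) 0.
Proof. by rewrite mxE enum_rankK. Qed.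

Lemma mul_reassoc M w : reassoc M *m reassocv w = reassocv (M *m w).
Proof.
apply: vectP => -[[a b] d]; rewrite mulmx_finE reassocvE mulmx_finE sum_reassoc.
apply: eq_bigr => -[[a' b'] d'] _.
by rewrite reassocvE -/(entry _ _ _) entry_mkoper.
Qed.

End Reassociation.

Section AtNode.
Variables A B D : finType.
Implicit Types (x : A) (w : vect R (B * D)%type).

(** P, C and A act on coin and memory jointly, whereas S acts on position and coin. The basis is
    bracketed for the latter; this form of a product state serves the former. *)
Definition at_node x w : vect R (A * B * D)%type := reassocv (tensv (ket R x) w).

Lemma at_node_ket x b d : at_node x (ket R (b, d)) = ket R (x, b, d).
Proof.
rewrite /at_node -ket_pair; apply: vectP => -[[a' b'] d'].
by rewrite reassocvE !ketE !xpair_eqE andbA.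
Qed.

Lemma at_nodeD x v w : at_node x (v + w) = at_node x v + at_node x w.
Proof. by rewrite /at_node tensvDr; apply/colP => i; rewrite !mxE. Qed.

Lemma at_nodeZ x a w : at_node x (a *: w) = a *: at_node x w.
Proof. by rewrite /at_node tensvZr; apply/colP => i; rewrite !mxE. Qed.

Lemma at_node_sum x I (r : seq I) (P : pred I) (F : I -> vect R (B * D)%type) :
  at_node x (\sum_(i <- r | P i) F i) = \sum_(i <- r | P i) at_node x (F i).
Proof.
apply: (big_morph _ (at_nodeD x)).
by apply/colP => i; rewrite !mxE mulr0.
Qed.

Lemma mul_at_node (W : oper R (B * D)%type) x w :
  reassoc (tens 1%:M W) *m at_node x w = at_node x (W *m w).
Proof. by rewrite /at_node mul_reassoc mul_tens mul1mx. Qed.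

End AtNode.

End Hilbert.

(** * The tree *)

Section Tree.
Variable L : nat.
Local Notation V := (node L).
Implicit Types (x y z : V) (d : 'I_4) (c : coin).

(** At a leaf [rcons x d] is too long and the default value makes the leaf its own child. *)
Definition child x d : V := insubd x (rcons x d).

Definition parent y : V := insubd y (take (size y).-1 y).

Lemma val_child x d : ~~ leaf x -> child x d = rcons x d :> seq 'I_4.
Proof.
move=> xL; rewrite /child insubdK // unfold_in size_rcons.
by rewrite ltn_neqAle xL size_bseq.
Qed.

Lemma val_parent y : parent y = take (size y).-1 y :> seq 'I_4.
Proof.
rewrite /parent insubdK // unfold_in size_takel ?leq_pred //.
exact: leq_trans (leq_pred _) (size_bseq y).
Qed.

Lemma child_parent y :
  (0 < size y)%N -> ~~ leaf (parent y) /\ child (parent y) (last ord0 y) = y.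
Proof.
move=> y0; have pL : ~~ leaf (parent y).
  rewrite /leaf val_parent size_takel ?leq_pred //.
  by have := size_bseq y; move: y0; lia.
split=> //; apply: val_inj; rewrite /= val_child // val_parent.
case: y y0 {pL} => s /= _; case/lastP: s => // s d _.
by rewrite size_rcons last_rcons -[in take _ _]cats1 take_size_cat.
Qed.

Lemma leads_sym x c y c' : leads x c y c' = leads y c' x c.
Proof. by case: c c' => [?|] [?|]. Qed.

(** This leaves the [pick] in [S_PC] no choice, so the shift is determined by any witness of
    [leads]. *)
Lemma leads_inj x c y c' z e :
  leads x c y c' -> leads x c z e -> (y, c') = (z, e).
Proof.
case: c c' e => [d|] [d'|] [d''|] //= /eqP h /eqP.
  by rewrite -h => /val_inj ->.
by rewrite h => /rcons_inj [/val_inj -> ->].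
Qed.

Lemma leads_child x d : ~~ leaf x -> leads x (Some d) (child x d) None.
Proof. by move=> xL; rewrite /= val_child. Qed.

(** * Valid nodes and their number at each depth *)

Section Validity.
Variable v : V -> 'I_4 -> bool.

Lemma valid_edge_sym x y : valid_edge v x y = valid_edge v y x.
Proof. by apply/eq_existsb => d; rewrite orbC. Qed.

Lemma valid_edge_child x d : ~~ leaf x -> valid_edge v x (child x d) = v x d.
Proof.
move=> xL; apply/existsP/idP => [[e]|vxd]; last first.
  by exists d; rewrite leads_child // vxd.
rewrite /= val_child // => /orP[] /andP[/eqP].
  by move=> /rcons_inj [->].
(* The edge read in the opposite orientation would make [x] longer than itself by two. *)
by move=> /(congr1 size); rewrite !size_rcons; lia.
Qed.

(** Reachability read off the address of [x]: the edges on the path from the root are the pairs [y],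
    [d] for which [rcons y d] is a prefix of [x]. Unlike connectivity, this can be followed from a
    node to its children. *)
Definition valid_node x : bool :=
  [forall y : V, forall d : 'I_4, prefix (rcons y d) x ==> v y d].

Lemma valid_root : valid_node root_node.
Proof.
by apply/forallP => y; apply/forallP => d; apply/implyP; rewrite /=; case: (bseqval y).
Qed.

Lemma valid_child x d :
  ~~ leaf x -> valid_node (child x d) = valid_node x && v x d.
Proof.
move=> xL; apply/forallP/andP => [vc|[/forallP vx vxd] y].
  split; last first.
    have /forallP/(_ d)/implyP := vc x; apply.
    by rewrite val_child ?prefix_refl.
  apply/forallP => y; apply/forallP => e; apply/implyP => pye.
  have /forallP/(_ e)/implyP := vc y; apply.
  by rewrite val_child // (prefix_trans pye) ?prefix_rcons.
apply/forallP => e; apply/implyP; rewrite val_child // => /prefixP [s].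
(* A prefix [rcons y e] of the extended address is either all of it, which gives the last edge, or
   already a prefix of [x]. *)
case/lastP: s => [|s e'].
  by rewrite cats0 => /rcons_inj [/val_inj <- <-].
rewrite -rcons_cat => /rcons_inj [xE _].
have /forallP/(_ e)/implyP := vx y; apply.
by rewrite xE prefix_prefix.
Qed.

Lemma child_leads x d y : leads x (Some d) y None -> ~~ leaf x /\ y = child x d.
Proof.
move=> xy; have xL : ~~ leaf x.
  have := size_bseq y; rewrite (eqP xy) size_rcons /leaf; lia.
by split=> //; case: (leads_inj xy (leads_child d xL)).
Qed.

(** A connecting walk may go up and down, but crossing a valid edge in either direction preserves
    [valid_node], so it never leaves the valid nodes. Conversely, climbing to the parent gives an
    induction on the depth. *)
Lemma connect_valid x : connect (valid_edge v) root_node x = valid_node x.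
Proof.
apply/idP/idP => [rx|].
  have cl : fingraph.closed (valid_edge v) valid_node.
    move=> y z /existsP[d /orP[]] /andP[/child_leads [yL ->] vyd].
      by rewrite /in_mem /= valid_child // vyd andbT.
    by rewrite /in_mem /= valid_child // vyd andbT.
  by have := closed_connect cl rx; rewrite /in_mem /= valid_root => <-.
elim: (size x) {-2}x (erefl (size x)) => [|k IHk] {}x xk.
  have -> : x = root_node by apply: val_inj; exact: size0nil.
  by rewrite connect0.
have [xL xE] : ~~ leaf (parent x) /\ child (parent x) (last ord0 x) = x.
  by apply: child_parent; rewrite xk.
rewrite -xE valid_child // => /andP[vp vd].
apply: (connect_trans (IHk _ _ vp)).
  by rewrite val_parent size_takel xk.
by apply: connect1; rewrite valid_edge_child.
Qed.

Definition layer k x : bool := valid_node x && (size x == k).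

Lemma valid_leafE x : valid_leaf v x = layer L x.
Proof. by rewrite /valid_leaf connect_valid andbC. Qed.

Lemma layer0 : layer 0 =1 pred1 root_node.
Proof.
move=> x; rewrite /layer /= size_eq0; apply/andP/eqP => [[_ /eqP x0]|->].
  exact: val_inj.
by rewrite valid_root.
Qed.

(** The operation is arbitrary because the recursion serves both to count nodes and to add up
    kets. *)
Lemma big_layerS (T : Type) (idx : T) (op : Monoid.com_law idx) (F : V -> T) k :
  (k < L)%N ->
  \big[op/idx]_(y | layer k.+1 y) F y =
  \big[op/idx]_(x | layer k x) \big[op/idx]_(d | v x d) F (child x d).
Proof.
move=> kL; rewrite pair_big_dep /=.
rewrite (reindex_onto (fun p : V * 'I_4 => child p.1 p.2)
                      (fun y => (parent y, last ord0 y))) /=.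
  apply: eq_bigl => -[x d] /=.
  case: (boolP (leaf x)) => xL.
    rewrite /layer (eqP xL) [L == k]gtn_eqF // andbF /=.
    apply/andP => -[/andP[_ ck] /eqP/(congr1 (fun p : V * 'I_4 => size p.1)) /=].
    (* The spurious child of a leaf is the leaf itself, whose parent is shorter, so the reindexing
       condition discards it. *)
    have cx : child x d = x.
      rewrite /child /insubd insubN // size_rcons (eqP xL); lia.
    by rewrite cx val_parent size_takel ?leq_pred // (eqP xL); lia.
  rewrite /layer valid_child // val_child // size_rcons eqSS.
  suff -> : (parent (child x d), last ord0 (rcons x d)) == (x, d).
    by rewrite andbT -andbA [v x d && _]andbC andbA.
  rewrite last_rcons xpair_eqE eqxx andbT; apply/eqP/val_inj => /=.
  rewrite val_parent val_child // size_rcons /= -cats1; exact: take_size_cat.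
by move=> y /andP[_ /eqP yk]; case: (@child_parent y); rewrite ?yk.
Qed.

(** Valid leaves are counted with [a] equal to 2, and all leaves with [a] equal to 4, by declaring
    every edge valid. *)
Lemma card_layer a k :
  (forall x, ~~ leaf x -> #|[pred d | v x d]| = a) -> (k <= L)%N ->
  #|[pred x | layer k x]| = (a ^ k)%N.
Proof.
move=> va; elim: k => [|k IHk] kL.
  by rewrite (eq_card layer0) card1.
rewrite -sum1_card big_layerS // expnSr -IHk; last exact: ltnW.
rewrite -sum_nat_const; apply: eq_bigr => x /andP[_ /eqP xk].
by rewrite sum1_card; apply: va; rewrite /leaf xk neq_ltn kL.
Qed.

End Validity.

Lemma card_leaf : #|[pred x : V | leaf x]| = (4 ^ L)%N.
Proof.
rewrite -(@card_layer (fun _ _ => true) 4 L) ?leqnn // => [|x _].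
  apply: eq_card => x; rewrite !inE /layer.
  suff -> : valid_node (fun _ _ => true) x by [].
  by apply/forallP => y; apply/forallP => d; rewrite implybT.
by rewrite -[RHS](card_ord 4); apply: eq_card.
Qed.

End Tree.

Lemma big_dir (T : Type) (idx : T) (op : Monoid.com_law idx) (F : 'I_4 -> T) :
  \big[op/idx]_(d < 4) F d =
  \big[op/idx]_(l < 2) op (F (even_dir l)) (F (odd_dir l)).
Proof.
rewrite !big_ord_recl !big_ord0 /= !Monoid.mulm1 Monoid.mulmA.
have dE k (kP : (k < 4)%N) (e : 'I_4) : e = k :> nat -> F e = F (inord k).
  by move=> ek; congr F; apply: val_inj; rewrite /= inordK.
by congr (op (op _ _) (op _ _)); apply: dE.
Qed.

Lemma card_valid_dir L (v : node L -> 'I_4 -> bool) x :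
  one_valid_per_pair v -> ~~ leaf x -> #|[pred d | v x d]| = 2.
Proof.
move=> vP xL; rewrite -sum1_card big_mkcond /= big_dir /=.
rewrite -[RHS](card_ord 2) -sum1_card; apply: eq_bigr => l _.
by have := vP x xL l; rewrite !inE; do 2 case: (v x _).
Qed.

(** * The spreading operator *)

Section Expi.
Variable R : realType.
Local Notation C := R[i].
Implicit Types s t : R.

Lemma expiD s t : expi (s + t) = expi s * expi t.
Proof.
by apply/eqP; rewrite eq_complex /= cosD sinD [_ * sin t + _]addrC !eqxx.
Qed.

Lemma expi0 : expi 0 = 1 :> C.
Proof. by rewrite /expi cos0 sin0. Qed.

Lemma expi_conj t : (expi t)^* = expi (- t).
Proof. by apply/eqP; rewrite eq_complex /= cosN sinN !eqxx. Qed.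

Lemma expi_norm t : (expi t)^* * expi t = 1.
Proof. by rewrite expi_conj -expiD addNr expi0. Qed.

Lemma expi_pi n : expi (pi * n%:R) = (-1) ^+ n :> C.
Proof.
elim: n => [|n IHn]; first by rewrite mulr0 expi0.
rewrite mulrS mulrDr mulr1 expiD IHn exprS; congr (_ * _).
by apply/eqP; rewrite eq_complex /= cospi sinpi oppr0 !eqxx.
Qed.

End Expi.

(** * The shift S and the phase estimation E *)

Section Operators.
Local Open Scope sesquilinear_scope.
Variables (R : realType) (L : nat) (v : node L -> 'I_4 -> bool).
Variables (phig phib : R) (g b : 'I_2).
Local Notation C := R[i].
Local Notation V := (node L).
Local Notation mem := 'I_2.
Local Notation S := (S_PC v phig phib).

Lemma phase_sym (x y : V) : phase v phig phib x y = phase v phig phib y x.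
Proof. by rewrite /phase valid_edge_sym. Qed.

(** Up to phases, the shift permutes the basis by this involution, whose fixed points are the loops;
    its unitarity follows. *)
Definition flip (u : V * coin) : V * coin :=
  odflt u [pick w : V * coin | leads u.1 u.2 w.1 w.2].

Lemma flip_leads (u w : V * coin) : leads u.1 u.2 w.1 w.2 -> flip u = w.
Proof.
case: u w => x c [y c'] /= xy.
rewrite /flip; case: pickP => [[z e] /= xz|/(_ (y, c'))].
  by rewrite /= (leads_inj xz xy).
by rewrite /= xy.
Qed.

Lemma flipK : involutive flip.
Proof.
move=> u; rewrite {2}/flip; case: pickP => [w uw|uN].
  by apply: flip_leads; rewrite leads_sym.
by rewrite /= /flip; case: pickP => // w; rewrite uN.
Qed.

Definition flip_phase (u : V * coin) : R :=
  if [pick w : V * coin | leads u.1 u.2 w.1 w.2] is Some w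
  then phase v phig phib u.1 w.1 else 0.

Lemma flip_phaseE (u w : V * coin) :
  leads u.1 u.2 w.1 w.2 -> flip_phase u = phase v phig phib u.1 w.1.
Proof.
case: u w => x c [y c'] /= xy.
rewrite /flip_phase; case: pickP => [[z e] /= xz|/(_ (y, c'))].
  by have [-> _] := leads_inj xz xy.
by rewrite /= xy.
Qed.

Lemma S_PC_ket u : S *m ket R u = expi (flip_phase u) *: ket R (flip u).
Proof.
rewrite on_basis_ket /flip_phase /flip; case: pickP => //= _.
by rewrite expi0 scale1r.
Qed.

Lemma S_PC_unitary : S \is unitarymx.
Proof.
apply: unitary_isometry => u w; rewrite !S_PC_ket innerZl innerZr inner_ket.
rewrite (inj_eq (inv_inj flipK)); case: eqVneq => [->|_]; last by rewrite !mulr0.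
by rewrite mulr1 expi_norm.
Qed.

Lemma S_PC_child (x : V) d : ~~ leaf x ->
  S *m ket R (x, Some d) =
  expi (if v x d then phig else phib) *: ket R (child x d, None).
Proof.
move=> xL; have xc := leads_child d xL.
rewrite S_PC_ket (flip_leads (w := (child x d, None))) //.
by rewrite (flip_phaseE (w := (child x d, None))) //= /phase valid_edge_child.
Qed.

(** Two shifts go down an edge and back, collecting its phase twice: position and downward coin form
    an eigenvector of the squared shift, which is what phase estimation needs. *)
Lemma S_PC_sqr (x : V) d : ~~ leaf x ->
  S ^+ 2 *m ket R (x, Some d) =
  expi (2 * (if v x d then phig else phib)) *: ket R (x, Some d).
Proof.
move=> xL; rewrite expr2 -[S * S]/(S *m S) -mulmxA S_PC_child // -scalemxAr.
have xc := leads_child d xL; have cx := xc; rewrite leads_sym in cx.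
rewrite S_PC_ket (flip_leads (w := (x, Some d))) // scalerA -expiD; congr (expi _ *: _).
rewrite (flip_phaseE (w := (x, Some d))) //=.
by rewrite phase_sym /phase valid_edge_child // mulr_natl mulr2n.
Qed.

Lemma S_op_unitary : S_op v phig phib \is unitarymx.
Proof.
exact: tens_unitary S_PC_unitary (unitarymx1 _ _).
Qed.

Lemma F_M_ket (k : mem) : F_M R *m ket R k =
  (sqrtC 2)^-1 *: \sum_(j : mem) (-1) ^+ (k * j) *: ket R j.
Proof.
rewrite on_basis_ket; congr (_ *: _); apply: eq_bigr => j _; congr (_ *: _).
by rewrite -expi_pi natrM; congr expi; field.
Qed.

Lemma sqrtC2_neq0 : sqrtC 2 != 0 :> C. Proof. by rewrite sqrtC_eq0 pnatr_eq0. Qed.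

Lemma conj_sqrtCV n : (((sqrtC n%:R)^-1)^* = (sqrtC n%:R)^-1 :> C).
Proof.
by apply: CrealP; rewrite ger0_real // invr_ge0 sqrtC_ge0 ler0n.
Qed.

Lemma F_M_unitary : F_M R \is unitarymx.
Proof.
apply: unitary_isometry => k k'; rewrite !F_M_ket innerZl innerZr conj_sqrtCV mulrA.
rewrite -invfM -expr2 sqrtCK !big_ord_recl !big_ord0 !addr0.
rewrite !(innerDl, innerDr, innerZl, innerZr) !inner_ket.
case: k k' => [[|[|//]] ?] [[|[|//]] ?]; rewrite !rmorphXn !rmorphN1 /=.
all: rewrite ?(mul0n, mul1n, muln0, muln1) ?(expr0, expr1) ?(mulr0,addr0,add0r).
all: by field.
Qed.

Lemma controlled_ket (W : oper R (V * coin)%type) u (j : mem) :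
  (\sum_(k : mem) tens (W ^+ k) (outer (ket R k) (ket R k))) *m ket R (u, j) =
  tensv (W ^+ j *m ket R u) (ket R j).
Proof.
rewrite ket_pair mulmx_suml (bigD1 j) //= mul_tens mul_outer inner_ket eqxx scale1r.
rewrite big1 ?addr0 // => k kj; rewrite mul_tens mul_outer inner_ket (negbTE kj).
by rewrite scale0r -(scale0r 0) tensvZr scale0r.
Qed.

Lemma E_op_unitary : E_op v phig phib \is unitarymx.
Proof.
apply: mul_unitarymx.
  by apply: tens_unitary (unitarymx1 _ _) _; rewrite trmxC_unitary F_M_unitary.
apply: unitary_isometry => -[u j] [w k].
rewrite !controlled_ket inner_tensv inner_ket xpair_eqE.
have [<-|_] := eqVneq j k; last by rewrite andbF mulr0.
rewrite inner_unitary ?inner_ket ?andbT ?mulr1 //.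
by do 2 apply: expmx_unitary; exact: S_PC_unitary.
Qed.

(** The controlled powers imprint the signs (-1)^(kj) on the uniform memory state, turning it into a
    multiple of F|k>, which the inverse Fourier transform sends to |k> without error. *)
Lemma E_op_phase u (k : mem) : S ^+ 2 *m ket R u = (-1) ^+ k *: ket R u ->
  E_op v phig phib *m \sum_(j : mem) ket R (u, j) = sqrtC 2 *: ket R (u, k).
Proof.
move=> Su; rewrite /E_op -mulmxA mulmx_sumr.
have DE (j : mem) : tensv ((S ^+ 2) ^+ j *m ket R u) (ket R j) =
    tensv (ket R u) ((-1) ^+ (k * j) *: ket R j).
  rewrite tensvZr -tensvZl; congr tensv.
  elim: (j : nat) => [|n IHn]; first by rewrite muln0 mul1mx scale1r.
  rewrite exprSr -[_ ^+ n * _]/(_ ^+ n *m _) -mulmxA Su -scalemxAr IHn scalerA.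
  by rewrite -exprD mulnS.
under eq_bigr do rewrite controlled_ket DE.
rewrite -tensv_sumr mul_tens mul1mx.
have FE : \sum_(j : mem) (-1) ^+ (k * j) *: ket R j = sqrtC 2 *: (F_M R *m ket R k).
  by rewrite F_M_ket scalerA divff ?scale1r // sqrtC2_neq0.
have /unitarymxP/mulmx1C FF := F_M_unitary.
by rewrite FE -scalemxAr mulmxA FF mul1mx tensvZr -ket_pair.
Qed.

Lemma dirP (d : 'I_4) : exists l, d = even_dir l \/ d = odd_dir l.
Proof.
exists (inord d./2).
have dlt : (d./2 < 2)%N by have := ltn_ord d; lia.
have [od|ed] := boolP (odd d); [right|left]; apply: val_inj => /=; rewrite !inordK //;
  have := ltn_ord d; lia.
Qed.

Lemma even_dir_eq l l' : (even_dir l == even_dir l') = (l == l').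
Proof. by case: l l' => [[|[|//]] ?] [[|[|//]] ?]; rewrite -!val_eqE /= !inordK. Qed.

Lemma odd_dir_eq l l' : (odd_dir l == odd_dir l') = (l == l').
Proof. by case: l l' => [[|[|//]] ?] [[|[|//]] ?]; rewrite -!val_eqE /= !inordK. Qed.

Lemma even_odd_dir l l' : (even_dir l == odd_dir l') = false.
Proof. by case: l l' => [[|[|//]] ?] [[|[|//]] ?]; rewrite -!val_eqE /= !inordK. Qed.

Lemma odd_even_dir l l' : (odd_dir l == even_dir l') = false.
Proof. by rewrite eq_sym even_odd_dir. Qed.

(** * The coin operator C and its unitarity *)

Hypothesis gb : g != b.

Let bg : b != g. Proof. by rewrite eq_sym. Qed.

Let Some_eq (d e : 'I_4) : (Some d == Some e) = (d == e). Proof. by []. Qed.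

Let dirE := (even_dir_eq, odd_dir_eq, even_odd_dir, odd_even_dir).

(** For signs, 1 + s^* s' is 2 or 0, so distinct g-vectors are orthogonal and each has squared norm
    2. *)
Lemma inner_g_even l l' s s' :
  inner (g_even g b l s) (g_even g b l' s') = (1 + s^* * s') * (l == l')%:R :> C.
Proof.
rewrite !(innerDl, innerDr, innerZl, innerZr) !inner_ket !xpair_eqE !Some_eq !dirE.
rewrite !eqxx (negbTE gb) (negbTE bg) !andbT /=; ring.
Qed.

Lemma inner_g_odd l l' s s' :
  inner (g_odd g b l s) (g_odd g b l' s') = (1 + s^* * s') * (l == l')%:R :> C.
Proof.
rewrite !(innerDl, innerDr, innerZl, innerZr) !inner_ket !xpair_eqE !Some_eq !dirE.
rewrite !eqxx (negbTE gb) (negbTE bg) !andbT /=; ring.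
Qed.

Lemma inner_g_even_odd l l' s s' :
  inner (g_even g b l s) (g_odd g b l' s') = 0 :> C.
Proof.
rewrite !(innerDl, innerDr, innerZl, innerZr) !inner_ket !xpair_eqE !Some_eq !dirE.
rewrite (negbTE gb) (negbTE bg) !andbF /=; ring.
Qed.

Lemma inner_g_odd_even l l' s s' :
  inner (g_odd g b l s) (g_even g b l' s') = 0 :> C.
Proof. by rewrite innerC inner_g_even_odd conjC0. Qed.

Let mulmxD4 (A1 A2 A3 A4 : oper R (coin * mem)%type)
    (w : vect R (coin * mem)%type) :
  (A1 + A2 + A3 + A4) *m w = A1 *m w + A2 *m w + A3 *m w + A4 *m w.
Proof. by rewrite !mulmxDl. Qed.

Let adjmxD4 (A1 A2 A3 A4 : oper R (coin * mem)%type) :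
  (A1 + A2 + A3 + A4) ^t* = A1 ^t* + A2 ^t* + A3 ^t* + A4 ^t*.
Proof. by rewrite !adjmxD. Qed.

(** The coefficients are parameters so that each image below reduces to supplying five families of
    inner products. *)
Lemma C_CM_mul (w : vect R (coin * mem)%type)
    (c1 c2 c3 c4 : 'I_2 -> C) (d : mem -> C) :
  (forall l, inner (g_even g b l 1) w = c1 l) ->
  (forall l, inner (g_odd g b l 1) w = c2 l) ->
  (forall l, inner (g_odd g b l (-1)) w = c3 l) ->
  (forall l, inner (g_even g b l (-1)) w = c4 l) ->
  (forall j, inner (ket R (None, j)) w = d j) ->
  C_CM R g b *m w = (sqrtC 2)^-1 *: \sum_(l < 2)
    (c1 l *: ket R (Some (even_dir l), g) + c2 l *: ket R (Some (odd_dir l), g)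
   + c3 l *: ket R (Some (odd_dir l), b) + c4 l *: ket R (Some (even_dir l), b))
  + \sum_(j : mem) d j *: ket R (None, j).
Proof.
move=> h1 h2 h3 h4 hd; rewrite mulmxDl -scalemxAl !mulmx_suml.
congr (_ *: _ + _); apply: eq_bigr => l _; last by rewrite mul_outer hd.
by rewrite mulmxD4 -h1 -h2 -h3 -h4; congr (_ + _ + _ + _); exact: mul_outer.
Qed.

Lemma inner_up_even j l s : inner (ket R (None, j)) (g_even g b l s) = 0.
Proof. by rewrite innerDr innerZr !inner_ket mulr0 addr0. Qed.

Lemma inner_up_odd j l s : inner (ket R (None, j)) (g_odd g b l s) = 0.
Proof. by rewrite innerDr innerZr !inner_ket mulr0 addr0. Qed.

Let scaler_sqrt2 (w : vect R (coin * mem)%type) :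
  (sqrtC 2)^-1 *: (2 *: w) = sqrtC 2 *: w.
Proof. by rewrite scalerA -{2}[2](sqrtCK 2) expr2 mulKf // sqrtC2_neq0. Qed.

Let sum_pick (x : C) (F : 'I_2 -> vect R (coin * mem)%type) l :
  \sum_(k < 2) (x * (k == l)%:R : C) *: F k = x *: F l.
Proof.
rewrite (bigD1 l) //= eqxx mulr1 big1 ?addr0 // => k kl.
by rewrite (negbTE kl) mulr0 scale0r.
Qed.

Let sum_zero (F : mem -> vect R (coin * mem)%type) : \sum_(k : mem) (0 : C) *: F k = 0.
Proof. by apply: big1 => k _; exact: scale0r. Qed.

Section Sum4.
Variables (x : C) (G1 G2 G3 G4 : 'I_2 -> vect R (coin * mem)%type) (l : 'I_2).

Lemma sum4_1 : \sum_(k < 2)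
    ((x * (k == l)%:R) *: G1 k + (0 : C) *: G2 k +
     (0 : C) *: G3 k + (0 : C) *: G4 k) =
  x *: G1 l.
Proof. by rewrite -sum_pick; apply: eq_bigr => k _; rewrite !scale0r ?addr0 ?add0r. Qed.

Lemma sum4_2 : \sum_(k < 2)
    ((0 : C) *: G1 k + (x * (k == l)%:R) *: G2 k +
     (0 : C) *: G3 k + (0 : C) *: G4 k) =
  x *: G2 l.
Proof. by rewrite -sum_pick; apply: eq_bigr => k _; rewrite !scale0r ?addr0 ?add0r. Qed.

Lemma sum4_3 : \sum_(k < 2)
    ((0 : C) *: G1 k + (0 : C) *: G2 k +
     (x * (k == l)%:R) *: G3 k + (0 : C) *: G4 k) =
  x *: G3 l.
Proof. by rewrite -sum_pick; apply: eq_bigr => k _; rewrite !scale0r ?addr0 ?add0r. Qed.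

Lemma sum4_4 : \sum_(k < 2)
    ((0 : C) *: G1 k + (0 : C) *: G2 k +
     (0 : C) *: G3 k + (x * (k == l)%:R) *: G4 k) =
  x *: G4 l.
Proof. by rewrite -sum_pick; apply: eq_bigr => k _; rewrite !scale0r ?addr0 ?add0r. Qed.

Lemma sum4_0 : \sum_(k < 2)
    ((0 : C) *: G1 k + (0 : C) *: G2 k +
     (0 : C) *: G3 k + (0 : C) *: G4 k) = 0.
Proof. by apply: big1 => k _; rewrite !scale0r ?addr0. Qed.

End Sum4.

Let onep1 : 1 + 1^* * 1 = 2 :> C. Proof. by rewrite conjC1 mulr1. Qed.
Let onem1 : 1 + 1^* * (-1) = 0 :> C. Proof. by rewrite conjC1 mul1r subrr. Qed.
Let onemp1 : 1 + (-1)^* * 1 = 0 :> C. Proof. by rewrite rmorphN1 mulr1 subrr. Qed.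
Let onemm1 : 1 + (-1)^* * (-1) = 2 :> C. Proof. by rewrite rmorphN1 mulrNN mulr1. Qed.

Lemma C_CM_even_plus l :
  C_CM R g b *m g_even g b l 1 = sqrtC 2 *: ket R (Some (even_dir l), g).
Proof.
pose c k : C := 2 * (k == l)%:R; pose z (k : 'I_2) : C := 0.
rewrite (@C_CM_mul _ c z z z z).
- by rewrite (sum4_1 2) sum_zero addr0 scaler_sqrt2.
- by move=> k; rewrite inner_g_even onep1 ?mul0r.
- by move=> k; rewrite inner_g_odd_even.
- by move=> k; rewrite inner_g_odd_even.
- by move=> k; rewrite inner_g_even onemp1 ?mul0r.
- by move=> j; rewrite inner_up_even.
Qed.

Lemma C_CM_even_minus l :
  C_CM R g b *m g_even g b l (-1) = sqrtC 2 *: ket R (Some (even_dir l), b).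
Proof.
pose c k : C := 2 * (k == l)%:R; pose z (k : 'I_2) : C := 0.
rewrite (@C_CM_mul _ z z z c z).
- by rewrite (sum4_4 2) sum_zero addr0 scaler_sqrt2.
- by move=> k; rewrite inner_g_even onem1 ?mul0r.
- by move=> k; rewrite inner_g_odd_even.
- by move=> k; rewrite inner_g_odd_even.
- by move=> k; rewrite inner_g_even onemm1 ?mul0r.
- by move=> j; rewrite inner_up_even.
Qed.

Lemma C_CM_odd_plus l :
  C_CM R g b *m g_odd g b l 1 = sqrtC 2 *: ket R (Some (odd_dir l), g).
Proof.
pose c k : C := 2 * (k == l)%:R; pose z (k : 'I_2) : C := 0.
rewrite (@C_CM_mul _ z c z z z).
- by rewrite (sum4_2 2) sum_zero addr0 scaler_sqrt2.
- by move=> k; rewrite inner_g_even_odd.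
- by move=> k; rewrite inner_g_odd onep1 ?mul0r.
- by move=> k; rewrite inner_g_odd onemp1 ?mul0r.
- by move=> k; rewrite inner_g_even_odd.
- by move=> j; rewrite inner_up_odd.
Qed.

Lemma C_CM_odd_minus l :
  C_CM R g b *m g_odd g b l (-1) = sqrtC 2 *: ket R (Some (odd_dir l), b).
Proof.
pose c k : C := 2 * (k == l)%:R; pose z (k : 'I_2) : C := 0.
rewrite (@C_CM_mul _ z z c z z).
- by rewrite (sum4_3 2) sum_zero addr0 scaler_sqrt2.
- by move=> k; rewrite inner_g_even_odd.
- by move=> k; rewrite inner_g_odd onem1 ?mul0r.
- by move=> k; rewrite inner_g_odd onemm1 ?mul0r.
- by move=> k; rewrite inner_g_even_odd.
- by move=> j; rewrite inner_up_odd.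
Qed.

Lemma C_CM_up j : C_CM R g b *m ket R (None, j) = ket R (None, j).
Proof.
pose z (k : 'I_2) : C := 0.
rewrite (@C_CM_mul _ z z z z (fun k => (k == j)%:R)).
- rewrite sum4_0 scaler0 add0r.
  rewrite (bigD1 j) //= eqxx scale1r big1 ?addr0 // => k kj.
  by rewrite (negbTE kj) scale0r.
- by move=> l; rewrite innerC inner_up_even conjC0.
- by move=> l; rewrite innerC inner_up_odd conjC0.
- by move=> l; rewrite innerC inner_up_odd conjC0.
- by move=> l; rewrite innerC inner_up_even conjC0.
- by move=> k; rewrite inner_ket xpair_eqE eqxx.
Qed.

Lemma C_CM_adj_mul (w : vect R (coin * mem)%type)
    (c1 c2 c3 c4 : 'I_2 -> C) (d : mem -> C) :
  (forall l, inner (ket R (Some (even_dir l), g)) w = c1 l) ->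
  (forall l, inner (ket R (Some (odd_dir l), g)) w = c2 l) ->
  (forall l, inner (ket R (Some (odd_dir l), b)) w = c3 l) ->
  (forall l, inner (ket R (Some (even_dir l), b)) w = c4 l) ->
  (forall j, inner (ket R (None, j)) w = d j) ->
  (C_CM R g b) ^t* *m w = (sqrtC 2)^-1 *: \sum_(l < 2)
    (c1 l *: g_even g b l 1 + c2 l *: g_odd g b l 1
   + c3 l *: g_odd g b l (-1) + c4 l *: g_even g b l (-1))
  + \sum_(j : mem) d j *: ket R (None, j).
Proof.
move=> h1 h2 h3 h4 hd; rewrite adjmxD adjmxZ conj_sqrtCV !adjmx_sum mulmxDl.
rewrite -scalemxAl !mulmx_suml.
apply: congr2; first apply: congr1.
  apply: eq_bigr => l _.
2: apply: eq_bigr => l _.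
2: by rewrite adj_outer mul_outer hd.
rewrite adjmxD4 mulmxD4 -h1 -h2 -h3 -h4; congr (_ + _ + _ + _).
all: by rewrite adj_outer; exact: mul_outer.
Qed.

Let C_CM_adj_even_g l : (C_CM R g b) ^t* *m ket R (Some (even_dir l), g) =
  (sqrtC 2)^-1 *: g_even g b l 1.
Proof.
pose c k : C := 1 * (k == l)%:R; pose z (k : 'I_2) : C := 0.
rewrite (@C_CM_adj_mul _ c z z z z).
- by rewrite (sum4_1 1) sum_zero addr0 scale1r.
all: move=> k; rewrite /c /z inner_ket xpair_eqE ?Some_eq ?dirE ?eqxx.
all: by rewrite ?(negbTE gb) ?(negbTE bg) ?andbT ?andbF ?mul1r.
Qed.

Let C_CM_adj_odd_g l : (C_CM R g b) ^t* *m ket R (Some (odd_dir l), g) =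
  (sqrtC 2)^-1 *: g_odd g b l 1.
Proof.
pose c k : C := 1 * (k == l)%:R; pose z (k : 'I_2) : C := 0.
rewrite (@C_CM_adj_mul _ z c z z z).
- by rewrite (sum4_2 1) sum_zero addr0 scale1r.
all: move=> k; rewrite /c /z inner_ket xpair_eqE ?Some_eq ?dirE ?eqxx.
all: by rewrite ?(negbTE gb) ?(negbTE bg) ?andbT ?andbF ?mul1r.
Qed.

Let C_CM_adj_odd_b l : (C_CM R g b) ^t* *m ket R (Some (odd_dir l), b) =
  (sqrtC 2)^-1 *: g_odd g b l (-1).
Proof.
pose c k : C := 1 * (k == l)%:R; pose z (k : 'I_2) : C := 0.
rewrite (@C_CM_adj_mul _ z z c z z).
- by rewrite (sum4_3 1) sum_zero addr0 scale1r.
all: move=> k; rewrite /c /z inner_ket xpair_eqE ?Some_eq ?dirE ?eqxx.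
all: by rewrite ?(negbTE gb) ?(negbTE bg) ?andbT ?andbF ?mul1r.
Qed.

Let C_CM_adj_even_b l : (C_CM R g b) ^t* *m ket R (Some (even_dir l), b) =
  (sqrtC 2)^-1 *: g_even g b l (-1).
Proof.
pose c k : C := 1 * (k == l)%:R; pose z (k : 'I_2) : C := 0.
rewrite (@C_CM_adj_mul _ z z z c z).
- by rewrite (sum4_4 1) sum_zero addr0 scale1r.
all: move=> k; rewrite /c /z inner_ket xpair_eqE ?Some_eq ?dirE ?eqxx.
all: by rewrite ?(negbTE gb) ?(negbTE bg) ?andbT ?andbF ?mul1r.
Qed.

Let C_CM_adj_up j : (C_CM R g b) ^t* *m ket R (None, j) = ket R (None, j).
Proof.
pose z (k : 'I_2) : C := 0.
rewrite (@C_CM_adj_mul _ z z z z (fun k => (k == j)%:R)).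
- rewrite sum4_0 scaler0 add0r.
  rewrite (bigD1 j) //= eqxx scale1r big1 ?addr0 // => k kj.
  by rewrite (negbTE kj) scale0r.
all: by move=> k; rewrite inner_ket xpair_eqE ?eqxx.
Qed.

Lemma mem_gb (j : mem) : j = g \/ j = b.
Proof.
case: g b gb j => [[|[|//]] ?] [[|[|//]] ?] // _ [[|[|//]] ?];
  by [left; exact: val_inj | right; exact: val_inj].
Qed.

(** The adjoint sends a downward basis ket to a normalized g-vector and C sends it back; as [g] and
    [b] exhaust the memory labels, this covers the whole basis. *)
Lemma C_CM_unitary : C_CM R g b \is unitarymx.
Proof.
apply/unitarymxP/oper_ketP => -[[d|] j]; rewrite mul1mx -mulmxA; last first.
  by rewrite C_CM_adj_up C_CM_up.
have [l [->|->]] := dirP d; case: (mem_gb j) => ->.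
- by rewrite C_CM_adj_even_g -scalemxAr C_CM_even_plus scalerA mulVf ?scale1r // sqrtC2_neq0.
- by rewrite C_CM_adj_even_b -scalemxAr C_CM_even_minus scalerA mulVf ?scale1r // sqrtC2_neq0.
- by rewrite C_CM_adj_odd_g -scalemxAr C_CM_odd_plus scalerA mulVf ?scale1r // sqrtC2_neq0.
- by rewrite C_CM_adj_odd_b -scalemxAr C_CM_odd_minus scalerA mulVf ?scale1r // sqrtC2_neq0.
Qed.

(** * Unitarity on the full space *)

Lemma at_each_nodeE (W : oper R (coin * mem)%type) :
  at_each_node L W = reassoc (tens 1%:M W).
Proof. by rewrite /at_each_node tensr_suml sum_outer_ket. Qed.

Lemma at_each_node_unitary (W : oper R (coin * mem)%type) :
  W \is unitarymx -> at_each_node L W \is unitarymx.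
Proof.
move=> uW; rewrite at_each_nodeE; apply/reassoc_unitary.
exact: tens_unitary (unitarymx1 _ _) uW.
Qed.

Lemma C_op_unitary : C_op R L g b \is unitarymx.
Proof.
apply: reassoc_unitary.
exact: tens_unitary (unitarymx1 _ _) C_CM_unitary.
Qed.

Lemma inner_s_ket : inner (s_ket R) (s_ket R) = 1.
Proof.
rewrite innerZl innerZr conj_sqrtCV mulrA -invfM -expr2 sqrtCK.
rewrite inner_suml (eq_bigr (fun=> 2)) => [|c _].
  by rewrite sumr_const card_ord -mulrnA mulVf // pnatr_eq0.
rewrite inner_suml (eq_bigr (fun=> 1)) => [|j _].
  by rewrite sumr_const card_ord.
rewrite inner_sumr (bigD1 c) //= inner_sumr (bigD1 j) //= inner_ket eqxx.
rewrite big1 ?addr0 => [|k kj]; last first.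
  by rewrite inner_ket xpair_eqE [j == k]eq_sym (negbTE kj) andbF.
rewrite big1 ?addr0 // => d dc; rewrite inner_sumr big1 // => k _.
by rewrite inner_ket xpair_eqE Some_eq [c == d]eq_sym (negbTE dc).
Qed.

Lemma inner_0_s_ket : inner (kcm R (Some ord0) ord0) (s_ket R) = (sqrtC 8)^-1.
Proof.
rewrite innerZr inner_sumr (bigD1 ord0) //= inner_sumr (bigD1 ord0) //= inner_ket eqxx.
rewrite big1 ?addr0 => [|k kj]; last first.
  by rewrite inner_ket xpair_eqE [ord0 == k]eq_sym (negbTE kj) andbF.
rewrite big1 ?addr0 ?mulr1 // => d dc; rewrite inner_sumr big1 // => k _.
by rewrite inner_ket xpair_eqE Some_eq [ord0 == d]eq_sym (negbTE dc).
Qed.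

Let inner_kcm c (j : mem) : inner (kcm R c j) (kcm R c j) = 1.
Proof. by rewrite inner_ket eqxx. Qed.

Let inner_0_s_lt1 : `|inner (kcm R (Some ord0) ord0) (s_ket R)| < 1.
Proof.
rewrite inner_0_s_ket normfV ger0_norm ?sqrtC_ge0 ?ler0n // invf_lt1.
  by rewrite -[X in X < _]sqrtC1 ltr_sqrtC ?qualifE /= ?ler0n ?ler01 ?ltr1n.
by rewrite sqrtC_gt0 ltr0n.
Qed.

Let inner_up_0_lt1 : `|inner (kcm R None g) (kcm R (Some ord0) ord0)| < 1.
Proof. by rewrite inner_ket normr0 ltr01. Qed.

Lemma P_op_unitary : P_op R L \is unitarymx.
Proof.
apply: at_each_node_unitary.
exact: transfer_unitary (inner_kcm _ _) inner_s_ket inner_0_s_lt1.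
Qed.

Lemma A_op_unitary : A_op R L g \is unitarymx.
Proof.
apply: at_each_node_unitary.
exact: transfer_unitary (inner_kcm _ _) (inner_kcm _ _) inner_up_0_lt1.
Qed.

Lemma U_op_unitary : U_op v phig phib g b \is unitarymx.
Proof.
have uAS := mul_unitarymx A_op_unitary S_op_unitary.
have uASC := mul_unitarymx uAS C_op_unitary.
have uASCE := mul_unitarymx uASC E_op_unitary.
exact: expmx_unitary (mul_unitarymx uASCE P_op_unitary).
Qed.

(** * The action of one layer, and of U, on the initial state *)

Hypothesis phigE : 2 * phig = 2 * pi * g%:R / 2.
Hypothesis phibE : 2 * phib = 2 * pi * b%:R / 2.
Hypothesis vP : one_valid_per_pair v.

(** The factor 1 / sqrt 8 comes from P, one sqrt 2 each from E and C, and the phase from S along a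
    valid edge. *)
Definition layer_amp : C := (sqrtC 8)^-1 * 2 * expi phig.

Lemma layer_amp_norm : layer_amp^* * layer_amp = 2^-1.
Proof.
rewrite /layer_amp !rmorphM /= conj_sqrtCV rmorph_nat.
transitivity ((sqrtC 8)^-1 ^+ 2 * 4 * ((expi phig)^* * expi phig)).
  by move: (sqrtC _)^-1 (expi _) => r e; ring.
by rewrite expi_norm exprVn sqrtCK; field.
Qed.

Let label (x : V) d : mem := if v x d then g else b.

Lemma P_op_ket x : P_op R L *m ket R (x, Some ord0, ord0) =
  (sqrtC 8)^-1 *: \sum_(d < 4) \sum_(j : mem) ket R (x, Some d, j).
Proof.
rewrite -at_node_ket /P_op at_each_nodeE mul_at_node.
rewrite (transferE (inner_kcm _ _) inner_s_ket inner_0_s_lt1).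
rewrite at_nodeZ at_node_sum; congr (_ *: _); apply: eq_bigr => d _.
by rewrite at_node_sum; apply: eq_bigr => j _; exact: at_node_ket.
Qed.

Lemma E_op_label x d : ~~ leaf x ->
  E_op v phig phib *m \sum_(j : mem) ket R (x, Some d, j) =
  sqrtC 2 *: ket R (x, Some d, label x d).
Proof.
move=> xL; apply: E_op_phase; rewrite S_PC_sqr // -expi_pi /label.
by case: (v x d); rewrite ?phigE ?phibE; congr (expi _ *: _); field.
Qed.

(** Exactly one edge of each pair is valid, so the labelled pair is either the even or the odd plus
    vector, and C concentrates it on its valid direction. *)
Lemma C_op_pairs x : ~~ leaf x ->
  C_op R L g b *m \sum_(d < 4) ket R (x, Some d, label x d) =
  sqrtC 2 *: \sum_(d < 4 | v x d) ket R (x, Some d, g).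
Proof.
move=> xL; under eq_bigr do rewrite -at_node_ket.
rewrite -at_node_sum /C_op mul_at_node [X in _ = _ *: X]big_mkcond /=.
rewrite !big_dir /= mulmx_sumr at_node_sum scaler_sumr; apply: eq_bigr => l _.
have := vP xL l; rewrite /label.
case: (v x (even_dir l)); case: (v x (odd_dir l)) => //= _.
  by rewrite addr0 -at_node_ket -at_nodeZ -C_CM_even_plus /g_even scale1r.
by rewrite add0r -at_node_ket -at_nodeZ -C_CM_odd_plus /g_odd scale1r.
Qed.

Lemma S_op_valid x d : ~~ leaf x -> v x d ->
  S_op v phig phib *m ket R (x, Some d, g) =
  expi phig *: ket R (child x d, None, g).
Proof.
move=> xL vxd; rewrite ket_pair mul_tens mul1mx S_PC_child // vxd.
by rewrite tensvZl -ket_pair.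
Qed.

Lemma A_op_ket y : A_op R L g *m ket R (y, None, g) = ket R (y, Some ord0, ord0).
Proof.
by rewrite -at_node_ket /A_op at_each_nodeE mul_at_node transferE // at_node_ket.
Qed.

(* stated for arbitrary matrices so that rewriting does not try to unify the
   actual operators by unfolding them *)
Lemma mulmx5_sum n (I : finType) (D : pred I) (A1 A2 A3 A4 A5 : 'M[C]_n)
    (w0 : 'cV[C]_n) (w1 w2 w3 w4 w5 : I -> 'cV[C]_n) x r e :
  A5 *m w0 = x *: \sum_d w1 d -> (forall d, A4 *m w1 d = r *: w2 d) ->
  A3 *m \sum_d w2 d = r *: \sum_(d | D d) w3 d ->
  (forall d, D d -> A2 *m w3 d = e *: w4 d) -> (forall d, A1 *m w4 d = w5 d) ->
  A1 *m A2 *m A3 *m A4 *m A5 *m w0 = (x * r ^+ 2 * e) *: \sum_(d | D d) w5 d.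
Proof.
move=> h5 h4 h3 h2 h1; rewrite -!mulmxA h5 -scalemxAr mulmx_sumr.
rewrite (eq_bigr _ (fun d _ => h4 d)) -scaler_sumr -!scalemxAr h3 -!scalemxAr.
rewrite !scalerA -mulrA -expr2 -[RHS]scalerA; congr (_ *: _).
rewrite !mulmx_sumr scaler_sumr; apply: eq_bigr => d Dd.
by rewrite h2 // -scalemxAr h1.
Qed.

Lemma layer_op_ket x : ~~ leaf x ->
  A_op R L g *m S_op v phig phib *m C_op R L g b *m E_op v phig phib *m P_op R L
    *m ket R (x, Some ord0, ord0) =
  layer_amp *: \sum_(d < 4 | v x d) ket R (child x d, Some ord0, ord0).
Proof.
move=> xL.
have := mulmx5_sum (P_op_ket x) (fun d => E_op_label d xL) (C_op_pairs xL)
  (fun d => @S_op_valid x d xL) (fun d => A_op_ket (child x d)).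
by rewrite sqrtCK.
Qed.

Lemma U_op_psi0 : U_op v phig phib g b *m psi0 R L =
  layer_amp ^+ L *: \sum_(y | valid_leaf v y) ket R (y, Some ord0, ord0).
Proof.
rewrite /U_op; set W := _ *m P_op R L.
have step k : (k <= L)%N -> W ^+ k *m psi0 R L =
    layer_amp ^+ k *: \sum_(y | layer v k y) ket R (y, Some ord0, ord0).
  elim: k => [_|k IHk kL].
    by rewrite mul1mx scale1r (eq_bigl _ _ (layer0 v)) big_pred1_eq.
  rewrite exprS -[W * _]/(W *m _) -mulmxA IHk ?(ltnW kL) // -scalemxAr big_layerS //.
  rewrite mulmx_sumr exprSr -scalerA; congr (_ *: _).
  rewrite scaler_sumr; apply: eq_bigr => x /andP[_ /eqP xk].
  by rewrite layer_op_ket // /leaf xk neq_ltn kL.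
by rewrite step //; congr (_ *: _); apply: eq_bigl => y; rewrite valid_leafE.
Qed.

End Operators.

(** * Trigonometric estimates *)

Section Trigonometry.
Variable R : realType.
Implicit Types t s : R.

Lemma sin_mvt t : 0 <= t -> exists2 c, 0 <= c <= t & sin t = cos c * t.
Proof.
move=> t0; have dsin x : x \in `]0, t[%R -> is_derive x 1 (@sin R) (cos x).
  by move=> _; exact: is_derive_sin.
have csin : {within `[0, t], continuous (@sin R)}.
  by apply: continuous_subspaceT => x; exact: continuous_sin.
have [c] := MVT_segment t0 dsin csin.
by rewrite sin0 !subr0 in_itv /= => ct ->; exists c.
Qed.

Lemma sin_le t : 0 <= t -> sin t <= t.
Proof.
move=> t0; have [c _ ->] := sin_mvt t0.
by rewrite -[X in _ <= X]mul1r ler_wpM2r // cos_le1.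
Qed.

(** The mean value point is at most [t] and cosine decreases on this interval. *)
Lemma mul_cos_le_sin t : 0 <= t <= pi -> t * cos t <= sin t.
Proof.
move=> /andP[t0 tpi]; have [c /andP[c0 ct] ->] := sin_mvt t0.
rewrite mulrC ler_wpM2r // leNgt ltr_cos -?leNgt // in_itv /= ?t0 ?c0 //.
exact: le_trans ct tpi.
Qed.

Lemma sin_triple t : sin (t + (t + t)) = sin t * (3 - 4 * sin t ^+ 2).
Proof.
rewrite !(sinD, cosD).
transitivity (sin t * (3 * cos t ^+ 2 - sin t ^+ 2)); first by ring.
by rewrite cos2sin2; ring.
Qed.

(** This is sin x <= x at x = pi / 6, where the sine is 1 / 2. The estimates in [odd_sin_large]
    would not close with 2 <= pi. *)
Lemma pi_ge3 : 3 <= pi :> R.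
Proof.
set a : R := pi / 6; have pi2 := @pi_ge2 R.
have a_gt0 : 0 < a by rewrite /a; lra.
have a3 : sin a * (3 - 4 * sin a ^+ 2) = 1.
  rewrite -sin_triple -[RHS](@sin_pihalf R); congr sin.
  by rewrite /a; field.
have sa : sin a = 2^-1.
  have : 0 < sin a.
    by apply: sin_gt0_pi; rewrite a_gt0 /a; lra.
  move: (sin a) a3 => x x3 x0.
  (* The triple-angle equation 3 x - 4 x^3 = 1, factored; positivity of [x] rules out the root
     -1. *)
  have /eqP : (x + 1) * (2 * x - 1) ^+ 2 = 0 by lra.
  by rewrite mulf_eq0 sqrf_eq0 => /orP[] /eqP; lra.
have := sin_le (ltW a_gt0); rewrite sa /a; lra.
Qed.

Lemma sin_ge_far t (d : R) : 0 <= d -> pi / 2 <= t <= pi - d -> sin d <= sin t.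
Proof.
move=> d0 /andP[t1 t2].
have -> : sin t = sin (pi - t) by rewrite sinB sinpi cospi; ring.
have pi2 := @pi_ge2 R.
rewrite leNgt ltr_sin -?leNgt ?in_itv /=; lra.
Qed.

(** The modulus of this number is the modulus of the marked amplitude after [k] iterations. *)
Definition odd_sin t k := sin ((2 * k + 1)%N%:R * t).

Lemma odd_sin0 t : odd_sin t 0 = sin t.
Proof. by rewrite /odd_sin muln0 mul1r. Qed.

Lemma odd_sin1 t : odd_sin t 1 = sin t * (3 - 4 * sin t ^+ 2).
Proof.
rewrite /odd_sin muln1 (_ : 3%:R * t = t + (t + t)); last by ring.
exact: sin_triple.
Qed.

(** From sin (a + 2t) + sin (a - 2t) = 2 cos (2t) sin a. Only sin t enters, so small cases are
    settled without finding the angle. *)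
Lemma odd_sinSS t k :
  odd_sin t k.+2 = 2 * (1 - 2 * sin t ^+ 2) * odd_sin t k.+1 - odd_sin t k.
Proof.
rewrite /odd_sin; set a : R := (2 * k.+1 + 1)%:R * t.
have -> : (2 * k.+2 + 1)%:R * t = a + (t + t) by rewrite /a !natrD !natrM -!natr1; ring.
have -> : (2 * k + 1)%:R * t = a - (t + t) by rewrite /a !natrD !natrM -!natr1; ring.
rewrite sinB !sinD [cos (t + t)]cosD -[cos t * cos t]expr2 cos2sin2; ring.
Qed.

Lemma odd_sin_half t k : sin t ^+ 2 = 2^-1 -> odd_sin t k ^+ 2 = 2^-1.
Proof.
move=> st; suff : odd_sin t k ^+ 2 = 2^-1 /\ odd_sin t k.+1 ^+ 2 = 2^-1 by case.
elim: k => [|k [IH1 IH2]].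
  by rewrite odd_sin0 odd_sin1 exprMn st; split=> //; field.
split=> //; rewrite odd_sinSS st (_ : 2 * (1 - 2 * 2^-1) = 0 :> R); last by field.
by rewrite mul0r sub0r sqrrN.
Qed.

Lemma odd_sin_quarter t k : sin t = 2^-1 -> 4^-1 <= odd_sin t k ^+ 2.
Proof.
move=> st; have dSS j : odd_sin t j.+2 = odd_sin t j.+1 - odd_sin t j.
  by rewrite odd_sinSS st; field.
(* Here 2 cos (2t) = 1, so the sequence changes sign every three terms: 1/2, 1, 1/2, -1/2, -1, -1/2.
   Three consecutive bounds therefore propagate. *)
suff : [/\ 4^-1 <= odd_sin t k ^+ 2, 4^-1 <= odd_sin t k.+1 ^+ 2 &
        4^-1 <= odd_sin t k.+2 ^+ 2] by case.
elim: k => [|k [IH1 IH2 IH3]].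
  by rewrite dSS odd_sin0 odd_sin1 st; split; lra.
split=> //; rewrite (_ : odd_sin t k.+3 = - odd_sin t k) ?sqrrN //.
by rewrite !dSS; ring.
Qed.

(** Since t s >= 1, the angle is at least pi / 2. Conversely t s <= 15 / 14 and t <= 75 / 196, so it
    is at most (15 / 28) pi + 3 t, which stays below pi - 1 / 5 once pi >= 3. *)
Lemma odd_sin_large t s k : 8 <= s ^+ 2 -> 0 < s -> 0 < t < pi / 2 -> sin t * s = 1 ->
  pi / 4 * s <= k%:R -> k%:R <= pi / 4 * s + 1 -> sin 5^-1 <= odd_sin t k.
Proof.
move=> s8 s0 /andP[t0 tpi] st k1 k2.
have pi3 := pi_ge3; have pi2 := @pihalf_02 R.
have tle : sin t <= t by apply: sin_le; exact: ltW.
have tge : t * cos t <= sin t by apply: mul_cos_le_sin; lra.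
have c0 : 0 < cos t by apply: cos_gt0_pihalf; lra.
have c2 : cos t ^+ 2 = 1 - sin t ^+ 2 := cos2sin2 t.
have si : sin t = s^-1.
  by apply: (mulIf (lt0r_neq0 s0)); rewrite st mulVf // lt0r_neq0.
have s2 : sin t ^+ 2 <= 8^-1.
  by rewrite si exprVn lef_pV2 // ?posrE ?exprn_gt0 //; lra.
(* Rational bounds 14 / 15 below sqrt (7 / 8), and next 5 / 14 above sqrt (1 / 8), both compared
   after squaring. *)
have c93 : 14 / 15 <= cos t.
  rewrite -(@ler_pXn2r _ 2) ?nnegrE //; lra.
have st0 : 0 < sin t by rewrite si invr_gt0.
have s354 : sin t <= 5 / 14.
  rewrite -(@ler_pXn2r _ 2) ?nnegrE //; lra.
have ts1 : 1 <= t * s by rewrite -st ler_wpM2r // ltW.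
have ts2 : t * s * (14 / 15) <= 1.
  rewrite -[leRHS]st mulrAC; apply: ler_wpM2r; first exact: ltW.
  apply: le_trans tge.
  exact: ler_wpM2l (ltW t0) _ _ c93.
have t2 : t * (14 / 15) <= 5 / 14.
  apply: le_trans s354; apply: le_trans tge.
  exact: ler_wpM2l (ltW t0) _ _ c93.
apply: sin_ge_far; first lra.
have -> : (2 * k + 1)%:R * t = 2 * k%:R * t + t by rewrite natrD natrM; ring.
have kt1 : pi / 4 * s * t <= k%:R * t by rewrite ler_wpM2r // ltW.
have kt2 : k%:R * t <= (pi / 4 * s + 1) * t by rewrite ler_wpM2r // ltW.
have p1 : pi * 1 <= pi * (t * s) by rewrite ler_wpM2l //; lra.
have p2 : pi * (t * s * (14 / 15)) <= pi * 1 by rewrite ler_wpM2l //; lra.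
apply/andP; split; lra.
Qed.

End Trigonometry.

(** * Amplitude amplification *)

Section Amplification.
Local Open Scope sesquilinear_scope.
Variables (R : realType) (T : finType).
Local Notation C := R[i].
Local Notation rc := (real_complex R).

(* multiplying by [cos t] keeps the second vector of the rotation plane, the
   normalization of [Psi - alpha sin t *: w], out of the statement *)
Lemma iter_rotation (G : oper R T) (w Psi : vect R T) (alpha : C) (t : R) k :
  alpha * alpha^* = 1 ->
  G *m w = (2 * alpha^* * rc (sin t)) *: Psi - w ->
  G *m Psi = (4 * rc (sin t) ^+ 2 - 1) *: Psi - (2 * alpha * rc (sin t)) *: w ->
  rc (cos t) *: iter k (mulmx G) Psi =
  (-1) ^+ k *: ((alpha * rc (sin ((2 * k)%N%:R * t))) *: w +
                rc (cos ((2 * k + 1)%N%:R * t)) *: Psi).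
Proof.
move=> aa Gw GPsi; elim: k => [|k IHk].
  by rewrite /= mul0r sin0 mulr0 scale0r add0r mul1r scale1r.
rewrite iterS scalemxAr IHk -scalemxAr mulmxDr -!scalemxAr Gw GPsi.
rewrite [in RHS]exprSr -[RHS]scalerA.
congr (_ *: _).
set a : R := (2 * k + 1)%N%:R * t.
have -> : (2 * k)%N%:R * t = a - t by rewrite /a natrD mulrDl mul1r addrK.
have -> : (2 * k.+1)%N%:R * t = a + t.
  by rewrite /a mulnS addnC natrD -[2%N]/(1 + 1)%N natrD addrA -natrD; ring.
have -> : (2 * k.+1 + 1)%N%:R * t = a + (t + t).
  by rewrite /a mulnS !natrD; ring.
have sE : rc (sin (a + t)) = rc (sin (a - t)) + 2 * rc (sin t) * rc (cos a).
  rewrite -[2](rmorph_nat rc) -!rmorphM -rmorphD; congr rc.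
  by rewrite sinD sinB; ring.
have cE : rc (cos (a + (t + t))) = rc (cos a) -
    4 * rc (sin t) ^+ 2 * rc (cos a) - 2 * rc (sin t) * rc (sin (a - t)).
  rewrite -[2](rmorph_nat rc) -[4](rmorph_nat rc) -!(rmorphXn, rmorphM, rmorphB).
  congr rc; rewrite cosD sinB cosD sinD.
  transitivity (cos a * (cos t ^+ 2 - sin t ^+ 2) - 2 * sin a * sin t * cos t).
    by ring.
  by rewrite cos2sin2; ring.
rewrite sE cE; apply/colP => l; rewrite !mxE.
move: (rc (sin (a - t))) (rc (sin t)) (rc (cos a)) => x y z.
transitivity (- ((alpha * (x + 2 * y * z)) * w l 0 +
  (z - 4 * y ^+ 2 * z - 2 * (alpha * alpha^*) * y * x) * Psi l 0)); first by ring.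
by rewrite aa; ring.
Qed.

(** Conjugation by a unitary turns the reflection about [p] into the reflection about [U *m p]. *)
Lemma reflection_mul (U O : oper R T) (p u : vect R T) : U \is unitarymx ->
  U *m (1%:M - outer p p *+ 2) *m U ^t* *m O *m u =
  O *m u - (2 * inner (U *m p) (O *m u)) *: (U *m p).
Proof.
move=> /unitarymxP uU; rewrite -!mulmxA; set x := O *m u.
rewrite mulmxBl mul1mx mulmxBr (mulmxA U) uU mul1mx; congr (_ - _).
rewrite -scaler_nat -scalemxAl mul_outer -!scalemxAr scalerA; congr ((_ * _) *: _).
by rewrite inner_adj adjmxK.
Qed.

End Amplification.

(** * The search plane spanned by the marked ket and the spread state *)

Section Search.
Variables (R : realType) (L : nat) (v : node L -> 'I_4 -> bool).
Variables (phig phib : R) (g b : 'I_2) (m : node L).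
Local Notation C := R[i].
Local Notation rc := (real_complex R).
Hypotheses (gb : g != b) (vP : one_valid_per_pair v).
Hypothesis phigE : 2 * phig = 2 * pi * g%:R / 2.
Hypothesis phibE : 2 * phib = 2 * pi * b%:R / 2.
Hypothesis mv : valid_leaf v m.

Let w : vect R _ := ket R (m, Some ord0 : coin, ord0 : 'I_2).
Let Psi := U_op v phig phib g b *m psi0 R L.
Let beta : C := layer_amp phig ^+ L.

Let PsiE : Psi = beta *: \sum_(y | valid_leaf v y) ket R (y, Some ord0, ord0).
Proof. exact: U_op_psi0. Qed.

Lemma oracle_ket (x : node L) (c : coin) (j : 'I_2) : oracle R m *m ket R (x, c, j) =
  ket R (x, c, j) - (2 * (x == m)%:R) *: ket R (x, c, j).
Proof.
have mE : (1%:M - outer (ket R m) (ket R m) *+ 2) *m ket R x =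
    (1 - 2 * (x == m)%:R) *: ket R x :> vect R (node L).
  rewrite mulmxBl mul1mx -scaler_nat -scalemxAl mul_outer inner_ket.
  rewrite scalerA scalerBl scale1r.
  by rewrite eq_sym; case: eqVneq => [->|]; rewrite ?mulr0 ?scale0r.
rewrite /oracle !ket_pair !mul_tens !mul1mx mE !tensvZl.
by rewrite -!ket_pair scalerBl scale1r.
Qed.

Let oracle_w : oracle R m *m w = - w.
Proof.
rewrite oracle_ket eqxx mulr1 -[X in X - _]scale1r -scalerBl -[RHS]scaleN1r.
by congr (_ *: _); ring.
Qed.

Let oracle_Psi : oracle R m *m Psi = Psi - (2 * beta) *: w.
Proof.
rewrite PsiE -scalemxAr mulmx_sumr.
rewrite (eq_bigr _ (fun y _ => oracle_ket y _ _)) sumrB scalerBr; congr (_ - _).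
rewrite (bigD1 m) //= eqxx mulr1 big1 ?addr0 => [|y /andP[_ ym]].
  by rewrite scalerA mulrC.
by rewrite (negbTE ym) mulr0 scale0r.
Qed.

Let inner_w_Psi : inner w Psi = beta.
Proof.
rewrite PsiE innerZr inner_sumr (bigD1 m) //= inner_ket eqxx big1 ?addr0 ?mulr1 //.
by move=> y /andP[_ ym]; rewrite inner_ket !xpair_eqE [m == y]eq_sym (negbTE ym).
Qed.

Let beta_norm : beta^* * beta = (2 ^- L).
Proof. by rewrite /beta rmorphXn -exprMn layer_amp_norm exprVn. Qed.

Let inner_Psi : inner Psi Psi = 1.
Proof.
rewrite inner_unitary ?inner_ket ?eqxx //; exact: U_op_unitary.
Qed.

(** One nonnegative term of the Born sum is kept, so a single coin and memory component suffices. *)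
Lemma prob_position_ge (psi : vect R _) c j (z : C) :
  inner (ket R (m, c, j)) psi = z -> complex.Re (`|z| ^+ 2) <= prob_position psi m.
Proof.
move=> <-; have ge0 (x : C) : 0 <= complex.Re (`|x| ^+ 2).
  by rewrite -add_Re2_Im2 /= addr_ge0 // sqr_ge0.
rewrite /prob_position (bigD1 c) //= (bigD1 j) //= -addrA lerDl addr_ge0 //.
  by apply: sumr_ge0 => k _; exact: ge0.
by apply: sumr_ge0 => d _; apply: sumr_ge0 => k _; exact: ge0.
Qed.

Lemma prob_final_state t k : 0 < sin t -> sin t ^+ 2 = 2 ^- L -> cos t != 0 ->
  odd_sin t k ^+ 2 <= prob_position (final_state v phig phib g b m k) m.
Proof.
(* The phase of the marked amplitude: it has modulus one because |beta|^2 = 2^-L = sin^2 t. *)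
move=> s0 s2 c0; pose alpha := beta * rc (sin t)^-1.
have rcs0 : rc (sin t) != 0 by rewrite fmorph_eq0 gt_eqF.
have rcc0 : rc (cos t) != 0 by rewrite fmorph_eq0.
have conjrc (x : R) : (rc x)^* = rc x by exact: conjc_real.
have bE : beta = alpha * rc (sin t) by rewrite /alpha fmorphV mulfVK.
have aa : alpha * alpha^* = 1.
  rewrite /alpha rmorphM /= conjrc mulrACA [beta * _]mulrC beta_norm.
  rewrite -rmorphM -expr2 exprVn s2 invrK rmorphXn rmorph_nat mulVf //.
clearbody alpha.
have itE (u : vect R _) : iteration v phig phib g b m *m u =
    oracle R m *m u - (2 * inner Psi (oracle R m *m u)) *: Psi.
  exact/reflection_mul/U_op_unitary.
have inPw : inner Psi w = beta^* by rewrite innerC inner_w_Psi.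
have Gw : iteration v phig phib g b m *m w = (2 * alpha^* * rc (sin t)) *: Psi - w.
  rewrite itE oracle_w -scaleN1r innerZr inPw bE rmorphM /= conjrc addrC -scaleNr.
  by congr (_ *: _ + _); ring.
have GPsi : iteration v phig phib g b m *m Psi =
    (4 * rc (sin t) ^+ 2 - 1) *: Psi - (2 * alpha * rc (sin t)) *: w.
  rewrite itE oracle_Psi innerBr innerZr inner_Psi inPw bE rmorphM /= conjrc.
  rewrite addrAC -[X in X - _ - _]scale1r -scalerBl.
  congr (_ *: _ - _ *: _); last by rewrite mulrA.
  transitivity (4 * (alpha * alpha^*) * rc (sin t) ^+ 2 - 1); first by ring.
  by rewrite aa mulr1.
pose z : C := (-1) ^+ k * alpha * rc (odd_sin t k).
have zE : inner w (final_state v phig phib g b m k) = z.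
  apply: (mulfI rcc0); rewrite -innerZr (iter_rotation k aa Gw GPsi).
  rewrite innerZr innerDr !innerZr inner_w_Psi inner_ket eqxx mulr1 bE /z.
  set a : R := (2 * k + 1)%N%:R * t.
  have -> : (2 * k)%N%:R * t = a - t by rewrite /a natrD mulrDl mul1r addrK.
  (* The component of [Psi] along [w] restores the missing term of sin (a - t), and the factor cos t
     introduced by [iter_rotation] cancels. *)
  have sE : rc (sin (a - t)) + rc (cos a) * rc (sin t) = rc (cos t) * rc (odd_sin t k).
    by rewrite -!rmorphM -rmorphD; congr rc; rewrite /odd_sin -/a sinB; ring.
  transitivity ((-1) ^+ k * alpha * (rc (sin (a - t)) + rc (cos a) * rc (sin t))).
    by move: (rc _) (rc (cos a)) (rc (sin t)) => x y u; ring.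
  by rewrite sE mulrCA.
have := prob_position_ge zE; suff -> : `|z| ^+ 2 = rc (odd_sin t k ^+ 2) by [].
rewrite normCK /z !rmorphM rmorphXn rmorphN1 /= conjrc.
transitivity (((-1) ^+ k * (-1) ^+ k) * (alpha * alpha^*) * rc (odd_sin t k) ^+ 2).
  by move: (rc _) => x; ring.
by rewrite aa -exprMn mulrNN !mulr1 expr1n !mul1r expr2.
Qed.

End Search.

(** * The number of steps and the success probability *)

Section Steps.
Variable R : realType.

Lemma nb_steps_bounds n : (0 < n)%N ->
  pi / 4 * Num.sqrt n%:R <= (nb_steps R n)%:R :> R /\
  (nb_steps R n)%:R <= pi / 4 * Num.sqrt n%:R + 1 :> R.
Proof.
move=> n0; rewrite /nb_steps; set x : R := pi / 4 * _.
have x0 : 0 <= x by rewrite mulr_ge0 ?sqrtr_ge0 // divr_ge0 ?pi_ge0.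
have c0 : 0 <= Num.ceil x by rewrite ceil_ge0; lra.
rewrite natr_absz ger0_norm //; have /andP[h1 h2] := ceil_itv x; split=> //.
by move: h1; rewrite intrB; lra.
Qed.

Lemma sqrt_pow2 L : Num.sqrt ((4 ^ L)%N%:R : R) = (2 ^ L)%N%:R.
Proof.
rewrite -[4%N]/(2 ^ 2)%N -expnM mulnC expnM natrX sqrtr_sqr ger0_norm //.
Qed.

Lemma nb_steps_bigO :
  (fun L : nat => (nb_steps R (2 ^ L))%:R : R^o) =O_\oo
  (fun L : nat => ((4 ^ L)%:R : R) `^ 4^-1 : R^o).
Proof.
(* The ceiling is at most (pi / 4) sqrt n + 1, where pi / 4 < 1 and 1 <= sqrt n. *)
apply/eqO_exP; exists 2; first by [].
near=> L.
have -> : ((4 ^ L)%:R : R) `^ 4^-1 = Num.sqrt (2 ^ L)%N%:R.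
  rewrite -sqrt_pow2 -!powR12_sqrt ?powR_ge0 ?ler0n // -powRrM; congr powR.
  by field.
have [_ h] := @nb_steps_bounds (2 ^ L) (expn_gt0 2 L).
have s1 : 1 <= Num.sqrt (2 ^ L)%N%:R :> R.
  by rewrite -[X in X <= _]sqrtr1 ler_sqrt ?ler0n // ler1n expn_gt0.
have pi4 := @pihalf_lt2 R.
rewrite !ger0_norm ?sqrtr_ge0 //; apply: le_trans h _.
have : pi / 4 * Num.sqrt (2 ^ L)%N%:R <= 1 * Num.sqrt (2 ^ L)%N%:R :> R.
  by rewrite ler_wpM2r ?sqrtr_ge0 //; lra.
lra.
Unshelve. all: by end_near. Qed.

End Steps.

(** Equal labels would force equal phases, but the set of phases has two elements. *)
Lemma distinct_labels (R : realType) (phig phib : R) (g b : 'I_2) :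
  [set phig; phib] = [set 0; pi / 2] ->
  2 * phig = 2 * pi * g%:R / 2 -> 2 * phib = 2 * pi * b%:R / 2 -> g != b.
Proof.
move=> phiE gE bE; apply/eqP => gb; have pp : phig = phib by move: gE bE; rewrite gb; lra.
have h0 : [set phig; phib] 0 by rewrite phiE; left.
have h1 : [set phig; phib] (pi / 2) by rewrite phiE; right.
have pi2 := @pihalf_ge1 R.
by move: h0 h1; rewrite pp; clear phiE => -[] /= h0 [] /= h1; lra.
Qed.

Lemma prob_lower_bound (R : realType) (L : nat) (v : node L -> 'I_4 -> bool)
    (phig phib : R) (g b : 'I_2) (m : node L) :
  (1 <= L)%N -> g != b -> one_valid_per_pair v ->
  2 * phig = 2 * pi * g%:R / 2 -> 2 * phib = 2 * pi * b%:R / 2 -> valid_leaf v m ->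
  Num.min 4^-1 (sin 5^-1 ^+ 2) <=
    prob_position (final_state v phig phib g b m (nb_steps R (2 ^ L))) m.
Proof.
move=> L1 gb vP gE bE mv; set k := nb_steps R _.
pose s : R := Num.sqrt (2 ^ L)%N%:R.
have s2 : s ^+ 2 = 2 ^+ L by rewrite sqr_sqrtr ?ler0n // natrX.
have s0 : 0 < s by rewrite sqrtr_gt0 ltr0n expn_gt0.
have s2ge : 2 <= s ^+ 2 by rewrite s2 -[X in X <= _]expr1 ler_weXn2l //; lra.
have s1 : 1 < s by rewrite -(@ltr_pXn2r _ 2) ?nnegrE ?ltW // expr1n; lra.
have sV1 : s^-1 < 1 by rewrite invf_lt1.
have sV0 : 0 < s^-1 by rewrite invr_gt0.
pose t := asin s^-1.
have sV : -1 <= s^-1 <= 1 by apply/andP; split; lra.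
have st : sin t = s^-1 by rewrite asinK // in_itv.
have tlt : t < pi / 2 by apply: asin_ltpi2; lra.
have tge : - (pi / 2) <= t by apply: asin_geNpi2.
have pi2 := @pihalf_ge1 R.
have t0 : 0 < t.
  by rewrite -(@ltr_sin R) ?sin0 ?st // in_itv /=; lra.
have c0 : cos t != 0 by rewrite gt_eqF //; apply: cos_gt0_pihalf; lra.
have st2 : sin t ^+ 2 = 2 ^- L by rewrite st exprVn s2.
have [k1 k2] := @nb_steps_bounds R (2 ^ L) (expn_gt0 2 L).
apply: le_trans (prob_final_state gb vP gE bE mv k _ st2 c0); last by rewrite st.
rewrite ge_min.
have [s8|s8] := lerP 8 (s ^+ 2); last first.
  apply/orP; left.
  have L2 : (L < 3)%N.
    rewrite ltnNge; apply/negP => L3; move: s8; rewrite s2 ltNge => /negP; apply.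
    have -> : 8 = 2 ^+ 3 :> R by rewrite !exprS expr0; lra.
    by rewrite ler_weXn2l //; lra.
  have {L2}[L2|L2] : L = 1%N \/ L = 2%N.
    by move: L1 L2; clear; case: L => [|[|[|?]]] //; [left|right].
    by rewrite odd_sin_half ?st2 ?L2 ?expr1 //; lra.
  (* For n = 4, sin t is the positive number with square 1 / 4. *)
  apply: odd_sin_quarter; apply: (@pexpIrn _ 2) => //.
  - by rewrite nnegrE st ltW.
  - by rewrite nnegrE invr_ge0.
  - by rewrite st2 L2 exprVn.
apply/orP; right.
have s5 : 0 <= sin 5^-1 :> R by apply: sin_ge0_pi; lra.
have sk : sin 5^-1 <= odd_sin t k.
  apply: (odd_sin_large s8 s0) => //; first by rewrite t0.
  by rewrite st mulVf // gt_eqF.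
by rewrite ler_pXn2r // nnegrE (le_trans s5).
Qed.

Theorem corollary1 (R : realType) :
  ((fun L : nat => (nb_steps R (2 ^ L))%:R : R^o) =O_\oo
     (fun L : nat => ((4 ^ L)%:R : R) `^ 4^-1 : R^o))
  /\
  exists2 c : R, 0 < c &
    forall (L : nat) (v : node L -> 'I_4 -> bool) (phig phib : R)
           (g b : 'I_2) (m : node L),
      (1 <= L)%N ->
      one_valid_per_pair v ->
      [set phig; phib] = [set 0; pi / 2] ->
      2 * phig = 2 * pi * g%:R / 2 ->
      2 * phib = 2 * pi * b%:R / 2 ->
      valid_leaf v m ->
      let N := #|[pred x : node L | leaf x]| in
      let n := #|[pred x : node L | valid_leaf v x]| in
      [/\ N = (4 ^ L)%N, n = (2 ^ L)%N, n%:R = Num.sqrt (N%:R : R) &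
          c <= prob_position
                 (final_state v phig phib g b m (nb_steps R n)) m].
Proof.
split; first exact: nb_steps_bigO.
(* The first value bounds the cases n < 8, the second those with n >= 8. *)
exists (Num.min 4^-1 (sin 5^-1 ^+ 2)).
  have pi2 := @pihalf_ge1 R.
  by rewrite lt_min exprn_gt0 ?andbT ?invr_gt0 //; apply: sin_gt0_pi; lra.
move=> L v phig phib g b m L1 vP phiE gE bE mv N n.
have NE : N = (4 ^ L)%N by exact: card_leaf.
have nE : n = (2 ^ L)%N.
  rewrite /n -(@card_layer L v 2 L) // => [|x]; last exact: card_valid_dir.
  by apply: eq_card => x; rewrite !inE valid_leafE.
split=> //; first by rewrite NE nE sqrt_pow2.
rewrite nE; apply: prob_lower_bound => //; exact: distinct_labels phiE gE bE.
Qed.
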